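(* Let $n\ge 1$ and $\mathbb{R}^n_+=\{x=(x_1,\ldots,x_n)\in\mathbb{R}^n: x_1>0\}$. (i) Let $\alpha_1,\ldots,\alpha_n$ be arbitrary real numbers and define \[ \beta_1=-\alpha_1^2+\tfrac14,\qquad \beta_m=-\alpha_m^2+\left(\alpha_{m-1}-\tfrac12\right)^2,\quad m=2,3,\ldots,n. \] Then for every $u\in C_0^\infty(\mathbb{R}^n_+)$, \[ \int_{\mathbb{R}^n_+}|\nabla u|^2dx\ \ge\ \int_{\mathbb{R}^n_+}\left(\frac{\beta_1}{x_1^2}+\frac{\beta_2}{x_1^2+x_2^2}+\cdots+\frac{\beta_n}{x_1^2+x_2^2+\cdots+x_n^2}\right)u^2dx . \] (ii) Conversely, suppose that real numbers $\beta_1,\ldots,\beta_n$ are such that \[ \int_{\mathbb{R}^n_+}|\nabla u|^2dx\ \ge\ \int_{\mathbb{R}^n_+}\left(\frac{\beta_1}{x_1^2}+\frac{\beta_2}{x_1^2+x_2^2}+\cdots+\frac{\beta_n}{x_1^2+x_2^2+\cdots+x_n^2}\right)u^2dx \] holds for every $u\in C_0^\infty(\mathbb{R}^n_+)$. Then there exist nonpositive constants $\alpha_1,\ldots,\alpha_n$ such that \[ \beta_1=-\alpha_1^2+\tfrac14,\qquad \beta_m=-\alpha_m^2+\left(\alpha_{m-1}-\tfrac12\right)^2,\quad m=2,3,\ldots,n. \]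
   Context: $C_0^\infty(\mathbb{R}^n_+)$ denotes smooth (real-valued) functions with compact support in the open half-space $\mathbb{R}^n_+$. *)

(* Defs.v *)
From HB Require Import structures.
From mathcomp Require Import all_boot all_order all_algebra.
From mathcomp Require Import all_classical all_reals all_analysis.
Set Implicit Arguments. Unset Strict Implicit. Unset Printing Implicit Defensive.
Import Order.TTheory GRing.Theory Num.Theory.
Import numFieldNormedType.Exports.
Local Open Scope classical_set_scope.
Local Open Scope ring_scope.

Definition basis_vec (R : realType) (n : nat) (i : 'I_n) : 'rV[R]_n :=
  delta_mx 0 i.

Definition partial (R : realType) (n : nat) (i : 'I_n)
  (f : 'rV[R]_n -> R) : 'rV[R]_n -> R :=
  fun x => 'D_(basis_vec R i) f x.

Fixpoint iter_partial (R : realType) (n : nat) (s : seq 'I_n)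
  (f : 'rV[R]_n -> R) : 'rV[R]_n -> R :=
  match s with
  | [::] => f
  | i :: s' => partial i (iter_partial s' f)
  end.

Definition smooth (R : realType) (n : nat) (f : 'rV[R]_n -> R) : Prop :=
  forall s : seq 'I_n,
    continuous (iter_partial s f) /\
    (forall (i : 'I_n) (x : 'rV[R]_n), derivable (iter_partial s f) x (basis_vec R i)).

Definition halfspace (R : realType) (n : nat) : set 'rV[R]_n.+1 :=
  [set x | 0 < x 0 ord0].

Definition C0inf_halfspace (R : realType) (n : nat) (u : 'rV[R]_n.+1 -> R) : Prop :=
  smooth u /\
  compact (closure [set x | u x != 0]) /\
  closure [set x | u x != 0] `<=` @halfspace R n.

Definition vcons (R : realType) (n : nat) (t : R) (y : 'rV[R]_n) : 'rV[R]_n.+1 :=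
  \row_(i < n.+1) oapp (fun j => y 0 j) t (unlift ord0 i).

(* Lebesgue integral over R^n, computed as the iterated one-dimensional
   Lebesgue integral (Fubini); used only for continuous compactly supported
   integrands. *)
Fixpoint integral_Rn (R : realType) (n : nat) : ('rV[R]_n -> R) -> R :=
  match n return ('rV[R]_n -> R) -> R with
  | 0 => fun f => f 0
  | n'.+1 => fun f =>
      Rintegral (@lebesgue_measure R) setT
        (fun t => integral_Rn (fun y => f (vcons t y)))
  end.

Definition grad_sq (R : realType) (n : nat) (u : 'rV[R]_n -> R) (x : 'rV[R]_n) : R :=
  \sum_(i < n) (partial i u x) ^+ 2.

Definition hardy_weight (R : realType) (n : nat) (beta : 'I_n.+1 -> R)
  (x : 'rV[R]_n.+1) : R :=
  \sum_(m < n.+1) beta m / (\sum_(k < n.+1 | (k <= m)%N) (x 0 k) ^+ 2).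

Definition hardy_ineq (R : realType) (n : nat) (beta : 'I_n.+1 -> R) : Prop :=
  forall u : 'rV[R]_n.+1 -> R, C0inf_halfspace u ->
    integral_Rn (fun x => hardy_weight beta x * (u x) ^+ 2)
    <= integral_Rn (grad_sq u).

Definition beta_of (R : realType) (n : nat) (alpha beta : 'I_n.+1 -> R) : Prop :=
  beta ord0 = - (alpha ord0) ^+ 2 + 1 / 4 /\
  forall m : 'I_n.+1, (0 < m)%N ->
    beta m = - (alpha m) ^+ 2 + (alpha (inord m.-1) - 1 / 2) ^+ 2.

(* Main.v *)
Require Import Defs.
From HB Require Import structures.
From mathcomp Require Import all_boot all_order all_algebra.
From mathcomp Require Import all_classical all_reals all_analysis.
From mathcomp Require Import ring lra.
Set Implicit Arguments. Unset Strict Implicit. Unset Printing Implicit Defensive.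
Import Order.TTheory GRing.Theory Num.Theory.
Import numFieldNormedType.Exports.
Local Open Scope classical_set_scope.
Local Open Scope ring_scope.

(** Let [r_k ^ 2 = x_0 ^ 2 + ... + x_k ^ 2] and let [phi] be the product of the
    [r_k ^ (- gamma_k)].  Putting [F = - grad (ln phi)] one has
    [|grad u|^2 = (div F - |F|^2) u^2 + |grad u + F u|^2 - div (F u^2)], and for the
    exponents [gamma_k = S_k - S_(k-1)], [S_k = alpha_k + (k - 1) / 2], the potential
    [div F - |F|^2] is the sum of the [beta_k / r_k ^ 2].  Integration gives (i).

    For (ii) one shows [beta_m <= (alpha_(m-1) - 1/2) ^ 2] (or [1/4] if [m = 0]) by
    induction, so that [alpha_m] can be defined by a square root.  When
    [alpha_k < 0] for [k < m], take [alpha_m = 0] and test with [u = phi v], where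
    [v] cuts off at [x_0 = eta] and at distance of order 1, with [x_j] near 3 for
    [j > m].  The remainder [|grad u + F u|^2 = phi^2 |grad v|^2] has an integral
    bounded uniformly in [eta], whereas the integral of [u^2 / r_m ^ 2] grows like
    [ln (1 / eta)].  Nonpositive [alpha_k] are first perturbed to negative ones. *)

(** Strict negativity in (ii) leaves a margin [sg > 0] with [alpha_k <= - m sg] for [k < m]. Then
    [phi ^ 2] is at most [x_0 ^ (1 + 2 m sg)] times the product over [1 <= k <= m] of
    [(x_0 ^ 2 + x_k ^ 2) ^ (- 1/2 - sg)]. Each factor is integrable in [x_k] because [sg > 0], with
    integral of order [x_0 ^ (- 2 sg)]; at [sg = 0] it would cost a logarithm, as large as the
    divergence to be detected. The powers of [sg] cancel, so [phi ^ 2] contributes at most order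
    [x_0] on the slice at [x_0]. As [|grad v| ^ 2] is of order [eta ^ 2 / x_0 ^ 4 + 1], the
    remainder is controlled by the integral of [eta ^ 2 / t ^ 3 + t] over [[eta, 1]]. On the box
    [0 <= x_j <= x_0], [1 <= j <= m], the slices of [phi ^ 2 / r_m ^ 2] are at least of order
    [1 / x_0], whence the logarithm.

    Integrals are iterated one-dimensional ones. Linearity and integration by parts come from
    induction on the dimension, for continuous functions supported in a fixed cube: slice integrals
    of such functions are again continuous with bounded support. *)

(** * One-dimensional integrals of continuous compactly supported functions *)

Section OneDim.
Variable R : realType.
Local Notation mu := (@lebesgue_measure R).
Implicit Types (g h G : R -> R) (M N a b t e : R).

Definition cc1 M g :=
  [/\ 0 < M, continuous g & forall t, M < `|t| -> g t = 0].

Lemma cc1_patch M g : cc1 M g -> g = g \_ `[- M, M].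
Proof.
case=> _ _ g0; apply/funext => t; rewrite patchE; case: ifPn => //.
rewrite notin_setE /= in_itv /= => /negP.
by rewrite -ler_norml -ltNge => /g0.
Qed.

Lemma cc1_integrable M g : cc1 M g -> mu.-integrable setT (EFin \o g).
Proof.
move=> cg; have [_ gc _] := cg.
have -> : EFin \o g = (EFin \o g) \_ `[- M, M].
  by rewrite {1}(cc1_patch cg) restrict_EFin.
apply: (integrable_mkcond _ _).1 => //.
apply: continuous_compact_integrable; first exact: segment_compact.
exact/continuous_subspaceT.
Qed.

Lemma cc1_Rintegral M g : cc1 M g ->
  Rintegral mu setT g = Rintegral mu `[- M, M] g.
Proof. by move=> cg; rewrite [RHS]Rintegral_mkcond -(cc1_patch cg). Qed.

Lemma cc1_lin M g h (a : R) : cc1 M g -> cc1 M h ->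
  Rintegral mu setT (fun t => g t + a * h t) =
  Rintegral mu setT g + a * Rintegral mu setT h.
Proof.
move=> cg ch; have ih := cc1_integrable ch; have ig := cc1_integrable cg.
rewrite RintegralD// ?RintegralZl//.
apply: eq_integrable (integrableZl measurableT a ih) => //.
Qed.

Lemma cc1_le M N g h : cc1 M g -> cc1 N h -> (forall t, g t <= h t) ->
  Rintegral mu setT g <= Rintegral mu setT h.
Proof.
move=> cg ch gh; apply: le_Rintegral => //.
  exact: cc1_integrable cg.
exact: cc1_integrable ch.
Qed.

Lemma FTC2_itv g G a b : a < b -> (forall t, a <= t <= b -> {for t, continuous g}) ->
  (forall t, a <= t <= b -> is_derive t 1 G (g t)) ->
  Rintegral mu `[a, b] g = G b - G a.
Proof.
move=> ab gc dG.
have Gc t : a <= t <= b -> {for t, continuous G}.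
  by move=> /dG dGt; apply/differentiable_continuous/derivable1_diffP/ex_derive.
have mem_oo t : t \in `]a, b[%R -> a <= t <= b.
  by rewrite in_itv /= => /andP[at_ tb]; rewrite !ltW.
rewrite /Rintegral (@continuous_FTC2 _ _ G)//.
- apply: continuous_in_subspaceT => t; rewrite inE /= in_itv /= => /gc; exact.
- split.
  + by move=> t /mem_oo/dG dGt; apply: ex_derive.
  + by apply/cvg_at_right_filter/Gc; rewrite lexx ltW.
  + by apply/cvg_at_left_filter/Gc; rewrite lexx ltW.
- by move=> t /mem_oo/dG dGt; rewrite derive1E derive_val.
Qed.

Lemma FTC2_continuous g G a b : a < b -> continuous g ->
  (forall t, is_derive t 1 G (g t)) ->
  Rintegral mu `[a, b] g = G b - G a.
Proof. by move=> ab gc dG; apply: FTC2_itv => // t _; exact: gc. Qed.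

Lemma cc1_bound M g (e : R) : cc1 M g -> (forall t, `|g t| <= e) ->
  `|Rintegral mu setT g| <= e * (2 * M).
Proof.
move=> cg ge; rewrite (cc1_Rintegral cg).
have [M0 gc _] := cg.
have ie (c : R) : mu.-integrable `[- M, M] (EFin \o cst c).
  apply: continuous_compact_integrable; first exact: segment_compact.
  exact/continuous_subspaceT/cst_continuous.
have ic (c : R) : Rintegral mu `[- M, M] (cst c) = c * (2 * M).
  have dc t : is_derive t 1 ( *%R c : R -> R) c.
    by apply: is_derive_eq; rewrite [LHS]mulr1.
  rewrite (FTC2_continuous _ _ dc); [lra|lra|exact: cst_continuous].
have ig : mu.-integrable `[- M, M] (EFin \o g).
  apply: continuous_compact_integrable; first exact: segment_compact.
  exact/continuous_subspaceT.
rewrite ler_norml -mulNr -!ic; apply/andP; split;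
  (apply: le_Rintegral; [by []|by [|exact: ie]|by [|exact: ie]|]) => t _ /=;
  by have := ge t; rewrite ler_norml => /andP[].
Qed.

Lemma cc1_sub M g a b : cc1 M g -> (forall t, 0 <= g t) ->
  Rintegral mu `[a, b] g <= Rintegral mu setT g.
Proof.
move=> cg g0; have ig := cc1_integrable cg.
rewrite [leLHS]Rintegral_mkcond; apply: le_Rintegral => //.
- rewrite -restrict_EFin; apply: (integrable_mkcond _ _).1 => //.
  exact: integrableS ig.
- by move=> t _; rewrite patchE; case: ifP.
Qed.

Lemma cc1_deriv0 M g (G : R -> R) : cc1 M g ->
  (forall t, is_derive t 1 G (g t)) -> (forall t, M < `|t| -> G t = 0) ->
  Rintegral mu setT g = 0.
Proof.
move=> [M0 gc g0] dG G0.
(* [G] is known to vanish only strictly beyond [M], so the endpoints are moved out to [M + 1]. *)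
have cg : cc1 (M + 1) g.
  by split => // [|t Mt]; [lra|apply: g0; lra].
rewrite (cc1_Rintegral cg) (FTC2_continuous _ _ dG)//; last by lra.
by rewrite !G0 ?subr0// ?normrN gtr0_norm; lra.
Qed.

End OneDim.

(** * Iterated integrals of continuous functions supported in a cube *)

Section CompactSupport.
Variable R : realType.
Implicit Types (M e d t : R) (n : nat).

Lemma rV_continuousP n (f : 'rV[R]_n -> R) :
  continuous f <-> forall (x : 'rV[R]_n) e, 0 < e -> exists2 d, 0 < d &
    forall y : 'rV[R]_n, (forall i, `|x 0 i - y 0 i| < d) -> `|f x - f y| < e.
Proof.
split=> [fc x e e0|H x].
  have /cvgrPdist_lt/(_ e e0)/nbhs_ballP[d d0 dP] := fc x.
  exists d => // y xy; apply: dP; split => // i j.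
  by rewrite ord1; exact: xy.
apply/(cvgrPdist_lt (F := nbhs x)) => e e0; have [d d0 dP] := H x e e0.
apply/nbhs_ballP; exists d => // y [_ xy]; apply: dP => i; exact: xy.
Qed.

Definition cc n M (f : 'rV[R]_n -> R) :=
  [/\ 0 < M, continuous f & forall (x : 'rV[R]_n) i, M < `|x 0 i| -> f x = 0].

Lemma cc_unif n M (f : 'rV[R]_n -> R) : cc M f -> forall e, 0 < e ->
  exists2 d, 0 < d &
    forall x y : 'rV[R]_n, (forall i, `|x 0 i - y 0 i| < d) -> `|f x - f y| < e.
Proof.
move=> [M0 fc f0] e e0.
(* The cube has a margin of 1: if [x] lies outside it and [y] is within 1 of [x], both are outside
   the support and [f x = f y = 0]. *)
pose K := [set x : 'rV[R]_n | forall i, x ord0 i \in `[- (M + 1), M + 1]].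
have cK : compact K.
  apply: (@rV_compact _ _ (fun=> `[(- (M + 1)), (M + 1)]%classic)) => _.
  exact: segment_compact.
pose P d (x : 'rV[R]_n) :=
  forall y : 'rV[R]_n, (forall i, `|x 0 i - y 0 i| < d) -> `|f x - f y| < e.
have near_d : \forall d \near 0^'+, K `<=` P d.
  apply: (compact_near_coveringP K).1 cK _ _ _ _ _ => x _.
  have [d d0 dP] := (rV_continuousP f).1 fc x _ (divr_gt0 e0 (ltr0n R 2)).
  exists ([set x' : 'rV[R]_n | forall i, `|x 0 i - x' 0 i| < d / 2], [set r : R | r < d / 2]).
    split => /=.
    - apply/nbhs_ballP; exists (d / 2) => /=; first by lra.
      by move=> y [_ xy] i; exact: xy.
    - by apply: nbhs_right_lt; lra.
  move=> [x' r] /= [xx' rd] y x'y.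
  have -> : f x' - f y = (f x - f y) - (f x - f x') by ring.
  apply: le_lt_trans (ler_normB _ _) _.
  suff : `|f x - f y| < e / 2 /\ `|f x - f x'| < e / 2 by lra.
  split; apply: dP => i; last by have := xx' i; lra.
  have -> : x 0 i - y 0 i = (x 0 i - x' 0 i) + (x' 0 i - y 0 i) by ring.
  apply: le_lt_trans (ler_normD _ _) _.
  by have := xx' i; have := x'y i; lra.
near (0 : R)^'+ => d.
exists (Num.min d 1); first by rewrite lt_min ltr01 andbT; near: d; exact: nbhs_right_gt.
move=> x y xy.
have dP : K `<=` P d by near: d.
have [xK|] := pselect (K x).
  by apply: dP => // i; apply: lt_le_trans (xy i) _; rewrite ge_min lexx.
move=> /existsNP[i] /negP; rewrite in_itv /= -ler_norml -ltNge => Mx.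
have xyi : `|x 0 i - y 0 i| < 1.
  by apply: lt_le_trans (xy i) _; rewrite ge_min lexx orbT.
have My : M < `|y 0 i|.
  by have := ler_normD (x 0 i - y 0 i) (y 0 i); rewrite subrK; lra.
by rewrite (f0 x i) ?(f0 y i) ?subrr ?normr0//; lra.
Unshelve. all: by end_near.
Qed.

Lemma vcons0 n t (y : 'rV[R]_n) : vcons t y 0 ord0 = t.
Proof. by rewrite mxE unlift_none. Qed.

Lemma vconsS n t (y : 'rV[R]_n) i : vcons t y 0 (lift ord0 i) = y 0 i.
Proof. by rewrite mxE liftK. Qed.

Lemma vcons_ltr n t t' (y y' : 'rV[R]_n) d :
  `|t - t'| < d -> (forall i, `|y 0 i - y' 0 i| < d) ->
  forall i, `|vcons t y 0 i - vcons t' y' 0 i| < d.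
Proof.
by move=> tt yy i; case: (unliftP ord0 i) => [j|] ->; rewrite ?vconsS ?vcons0.
Qed.

Lemma cc_slice n M (f : 'rV[R]_n.+1 -> R) t :
  cc M f -> cc M (fun y => f (vcons t y)).
Proof.
move=> [M0 fc f0]; split=> // [|y i My]; last first.
  by apply: (f0 _ (lift ord0 i)); rewrite vconsS.
apply/rV_continuousP => y e e0.
have [d d0 dP] := (rV_continuousP f).1 fc (vcons t y) e e0.
exists d => // y' yy'; apply: dP; apply: vcons_ltr => //.
by rewrite subrr normr0.
Qed.

Lemma cc_lin n M (f g : 'rV[R]_n -> R) (a : R) : cc M f -> cc M g ->
  cc M (fun x => f x + a * g x).
Proof.
move=> [M0 fc f0] [_ gc g0]; split=> // [x|x i Mx].
  exact: (cvgD (fc x) (cvgM (cvg_cst a) (gc x))).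
by rewrite (f0 _ i)// (g0 _ i)// mulr0 addr0.
Qed.

(** The two hypotheses are the induction hypothesis of [integral_Rn_props]. Linearity one dimension
    higher needs integrable slice integrals, hence their continuity; this in turn follows from
    linearity and the sup bound in dimension [n], applied to the difference of two slices, which is
    uniformly small by [cc_unif]. *)
Lemma integral_Rn_step n :
  (forall M (f g : 'rV[R]_n -> R) a, cc M f -> cc M g ->
     integral_Rn (fun x => f x + a * g x) = integral_Rn f + a * integral_Rn g) ->
  (forall M (f : 'rV[R]_n -> R) e, cc M f -> (forall x, `|f x| <= e) ->
     `|integral_Rn f| <= e * (2 * M) ^+ n) ->
  forall M (f : 'rV[R]_n.+1 -> R), cc M f ->
    cc1 M (fun t => integral_Rn (fun y => f (vcons t y))).
Proof.
move=> lin bnd M f cf; have [M0 fc f0] := cf.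
split=> // [t|t Mt]; last first.
  apply/eqP; rewrite -normr_le0; have := bnd M _ 0 (cc_slice t cf).
  rewrite mul0r; apply => y.
  by rewrite (f0 _ ord0) ?normr0 ?vcons0.
apply/cvgrPdist_lt => e e0.
have C0 : 0 < (2 * M) ^+ n by apply: exprn_gt0; lra.
pose e' := e / 2 / (2 * M) ^+ n.
have e'0 : 0 < e' by rewrite !divr_gt0.
have [d d0 dP] := cc_unif cf e'0.
near=> t'.
have tt' : `|t - t'| < d by near: t'; apply: cvgr_dist_lt.
have := bnd M _ e' (cc_lin (-1) (cc_slice t cf) (cc_slice t' cf)).
rewrite (lin M) ?mulN1r; [|exact: cc_slice..].
move=> H; apply: le_lt_trans (H _) _; last by rewrite divfK ?gt_eqF//; lra.
move=> y; rewrite mulN1r ltW//; apply: dP; apply: vcons_ltr => // i.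
by rewrite subrr normr0.
Unshelve. all: by end_near.
Qed.

Lemma integral_Rn_props n :
  (forall M (f g : 'rV[R]_n -> R) a, cc M f -> cc M g ->
     integral_Rn (fun x => f x + a * g x) = integral_Rn f + a * integral_Rn g) /\
  (forall M (f : 'rV[R]_n -> R) e, cc M f -> (forall x, `|f x| <= e) ->
     `|integral_Rn f| <= e * (2 * M) ^+ n).
Proof.
elim: n => [|n [lin bnd]]; first by split=> [//|M f e _ fe]; rewrite expr0 mulr1; exact: fe.
have step := integral_Rn_step lin bnd; split=> [M f g a cf cg|M f e cf fe] /=.
  rewrite -(cc1_lin a (step _ _ cf) (step _ _ cg)).
  by congr Rintegral; apply/funext => t; rewrite (lin M)//; exact: cc_slice.
rewrite exprSr mulrA; apply: (cc1_bound (step _ _ cf)) => t.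
by apply: bnd => //; exact: cc_slice.
Qed.

Lemma integral_Rn_lin n M (f g : 'rV[R]_n -> R) a : cc M f -> cc M g ->
  integral_Rn (fun x => f x + a * g x) = integral_Rn f + a * integral_Rn g.
Proof. exact: (integral_Rn_props n).1. Qed.

Lemma integral_Rn_bound n M (f : 'rV[R]_n -> R) e : cc M f ->
  (forall x, `|f x| <= e) -> `|integral_Rn f| <= e * (2 * M) ^+ n.
Proof. exact: (integral_Rn_props n).2. Qed.

Lemma cc_integral n M (f : 'rV[R]_n.+1 -> R) : cc M f ->
  cc1 M (fun t => integral_Rn (fun y => f (vcons t y))).
Proof.
by apply: integral_Rn_step; [exact: integral_Rn_lin|exact: integral_Rn_bound].
Qed.

Lemma cc_cst0 n M : 0 < M -> cc M (fun=> 0 : R) (n := n).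
Proof. by split=> //; exact: cst_continuous. Qed.

Lemma integral_Rn0 n : integral_Rn (fun _ : 'rV[R]_n => 0 : R) = 0.
Proof.
apply/eqP; rewrite -normr_le0.
by have := integral_Rn_bound (cc_cst0 n ltr01) (e := 0); rewrite mul0r; apply=> x; rewrite normr0.
Qed.

Lemma integral_Rn_ge0 n (f : 'rV[R]_n -> R) : (forall x, 0 <= f x) -> 0 <= integral_Rn f.
Proof.
elim: n f => [|n IH] f f0 /=; first exact: f0.
by apply: Rintegral_ge0 => t _; exact: IH.
Qed.

Lemma integral_Rn_le n M (f g : 'rV[R]_n -> R) : cc M f -> cc M g ->
  (forall x, f x <= g x) -> integral_Rn f <= integral_Rn g.
Proof.
move=> cf cg fg; rewrite -subr_ge0 -mulN1r -(integral_Rn_lin _ cg cf).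
by apply: integral_Rn_ge0 => x; rewrite mulN1r subr_ge0.
Qed.

Lemma integral_Rn_sum n M (I : Type) (r : seq I) (F : I -> 'rV[R]_n -> R) :
  0 < M -> (forall i, cc M (F i)) ->
  cc M (fun x => \sum_(i <- r) F i x) /\
  integral_Rn (fun x => \sum_(i <- r) F i x) = \sum_(i <- r) integral_Rn (F i).
Proof.
move=> M0 cF; elim: r => [|i r [cr ir]].
  under eq_fun do rewrite big_nil.
  by rewrite big_nil integral_Rn0; split=> //; exact: cc_cst0.
have -> : (fun x => \sum_(j <- i :: r) F j x) =
          (fun x => F i x + 1 * \sum_(j <- r) F j x).
  by apply/funext => x; rewrite big_cons mul1r.
by rewrite big_cons (integral_Rn_lin _ (cF i) cr) ir mul1r; split=> //; exact: cc_lin.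
Qed.

End CompactSupport.

(** * Differentiation under the integral sign; integrals of partial derivatives vanish *)

Section Divergence.
Variable R : realType.
Implicit Types (M e d t h : R) (n : nat).

Lemma cvg_is_derive (g : R -> R) t (l : R) :
  h^-1 * (g (h + t) - g t) @[h --> 0^'] --> l -> is_derive t 1 g l.
Proof.
move=> H.
have H' : h^-1 *: ((g \o shift t) (h *: (1 : R)) - g t) @[h --> (0 : R)^'] --> l.
  by rewrite (_ : (fun h => _) = (fun h => h^-1 * (g (h + t) - g t)))//;
    apply/funext => h; rewrite /= [h *: 1]mulr1.
by apply: DeriveDef; [apply/cvg_ex; exists l|apply: cvg_lim].
Qed.

Lemma MVT_increment (g dg : R -> R) t h :
  (forall s : R, is_derive s 1 g (dg s)) ->
  exists2 c, `|t - c| <= `|h| & g (h + t) - g t = dg c * h.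
Proof.
move=> dgP.
have gc : continuous g.
  by move=> s; apply/differentiable_continuous/derivable1_diffP/ex_derive.
have [h0|h0] := leP 0 h.
  have [||c] := @MVT_segment R g dg t (h + t) _ (fun s _ => dgP s).
  - by lra.
  - exact: continuous_subspaceT.
  rewrite in_itv /= => /andP[tc ch] ->; exists c; last by congr (_ * _); ring.
  by rewrite (ger0_norm h0) ler0_norm; lra.
have [||c] := @MVT_segment R g dg (h + t) t _ (fun s _ => dgP s).
- by lra.
- exact: continuous_subspaceT.
rewrite in_itv /= => /andP[tc ch] eq_c; exists c; last first.
  by rewrite -opprB eq_c; ring.
by rewrite (ltr0_norm h0) ger0_norm; lra.
Qed.

Lemma vcons_add0 n t h (y : 'rV[R]_n) :
  h *: basis_vec R ord0 + vcons t y = vcons (h + t) y.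
Proof.
apply/rowP => i; rewrite !mxE; case: (unliftP ord0 i) => [j|] -> /=.
  by rewrite mulr0 add0r.
by rewrite mulr1.
Qed.

Lemma vcons_addS n t h (y : 'rV[R]_n) j :
  h *: basis_vec R (lift ord0 j) + vcons t y = vcons t (h *: basis_vec R j + y).
Proof.
apply/rowP => i; rewrite !mxE; case: (unliftP ord0 i) => [k|] -> /=.
  by rewrite !mxE (inj_eq lift_inj).
by rewrite mulr0 add0r.
Qed.

Lemma derivable_slice n (f : 'rV[R]_n.+1 -> R) j t y :
  derivable f (vcons t y) (basis_vec R (lift ord0 j)) ->
  derivable (fun y => f (vcons t y)) y (basis_vec R j).
Proof.
rewrite /derivable; under eq_fun do rewrite /= vcons_addS.
by [].
Qed.

Lemma partial_slice n (f : 'rV[R]_n.+1 -> R) j t y :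
  partial (lift ord0 j) f (vcons t y) = partial j (fun y => f (vcons t y)) y.
Proof.
by rewrite /partial /derive; under eq_fun do rewrite /= vcons_addS.
Qed.

Lemma is_derive_vcons0 n (f : 'rV[R]_n.+1 -> R) t y :
  derivable f (vcons t y) (basis_vec R ord0) ->
  is_derive t 1 (fun t => f (vcons t y)) (partial ord0 f (vcons t y)).
Proof.
move=> df; apply: cvg_is_derive.
move: df; rewrite /derivable /partial /derive.
by under eq_fun do rewrite /= vcons_add0.
Qed.

Lemma partial_near0 n (f : 'rV[R]_n -> R) i (x : 'rV[R]_n) :
  (\forall y \near x, f y = 0) -> partial i f x = 0.
Proof.
move=> f0; rewrite /partial (near_eq_derive (g := cst 0)) ?derive_cst//.
Qed.

Lemma near_coord n (P : set R) (i : 'I_n) (x : 'rV[R]_n) :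
  open P -> P (x 0 i) -> \forall y \near x, P ((y : 'rV[R]_n) 0 i).
Proof.
move=> oP Px; have := @coord_continuous R 1 n 0 i x.
by move=> /(_ P); apply; exact: open_nbhs_nbhs.
Qed.

Lemma cc_partial n M (f : 'rV[R]_n -> R) i :
  cc M f -> continuous (partial i f) -> cc M (partial i f).
Proof.
move=> [M0 fc f0] dfc; split=> // x j Mx; apply: partial_near0.
have [xM|xM] : M < x 0 j \/ x 0 j < - M.
  by move: Mx; rewrite ltr_normr => /orP[]; [left|right; lra].
- have := near_coord (@open_gt R M) xM.
  by apply: filterS => y My; apply: (f0 _ j); rewrite ltr_normr My.
- have := near_coord (@open_lt R (- M)) xM.
  by apply: filterS => y /= My; apply: (f0 _ j); rewrite ltr_normr ltrNr My orbT.
Qed.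

(** By the mean value theorem the difference quotient at [y] is the partial derivative at some point
    [c], depending on [y], within [|h|] of [t]. Uniform continuity of the partial derivative makes
    the error small uniformly in [y], so no dominated convergence is involved. *)
Lemma is_derive_integral n M (f : 'rV[R]_n.+1 -> R) t :
  cc M f -> (forall x, derivable f x (basis_vec R ord0)) ->
  continuous (partial ord0 f) ->
  is_derive t 1 (fun t => integral_Rn (fun y => f (vcons t y)))
    (integral_Rn (fun y => partial ord0 f (vcons t y))).
Proof.
move=> cf df dfc; have cdf := cc_partial cf dfc.
have [M0 fc f0] := cf.
apply: cvg_is_derive; apply/cvgrPdist_le => e e0.
have C0 : 0 < (2 * M) ^+ n by apply: exprn_gt0; lra.
have e'0 : 0 < e / (2 * M) ^+ n by rewrite divr_gt0.
have [d d0 dP] := cc_unif cdf e'0.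
near=> h.
have h0 : h != 0 by near: h; exact: nbhs_dnbhs_neq.
have hd : `|h| < d by near: h; exact: dnbhs0_lt.
have cS s := cc_slice s cf.
have cdS s := cc_slice s cdf.
have cq := cc_lin (-1) (cS (h + t)) (cS t).
have cqd := cc_lin (- h^-1) (cdS t) cq.
have := integral_Rn_lin (- h^-1) (cdS t) cq.
rewrite (integral_Rn_lin _ (cS (h + t)) (cS t)) mulN1r mulNr => <-.
apply: le_trans (integral_Rn_bound cqd (e := e / (2 * M) ^+ n) _) _; last first.
  by rewrite divfK ?gt_eqF.
move=> y.
have [c tc E] := MVT_increment t h (fun s => is_derive_vcons0 (df (vcons s y))).
rewrite mulN1r E [_ + _](_ : _ = partial ord0 f (vcons t y) -
  partial ord0 f (vcons c y)); last by field.
apply/ltW/dP; apply: vcons_ltr.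
  exact: le_lt_trans tc hd.
by move=> i; rewrite subrr normr0.
Unshelve. all: by end_near.
Qed.

(** A derivative in a tail coordinate integrates to 0 on every slice, by induction. A derivative in
    the first coordinate becomes the derivative of the slice integral, a compactly supported
    function of one variable. *)
Lemma integral_partial n M (f : 'rV[R]_n -> R) i :
  cc M f -> (forall x, derivable f x (basis_vec R i)) ->
  continuous (partial i f) -> integral_Rn (partial i f) = 0.
Proof.
elim: n f i => [f []//|n IH f i cf df dfc].
have cdf := cc_partial cf dfc; have [M0 fc f0] := cf.
case: (unliftP ord0 i) => [j|] Ei; rewrite Ei in df dfc cdf *.
  rewrite /= [X in Rintegral _ _ X](_ : _ = cst 0).
    by rewrite Rintegral_cst// mul0r.
  apply/funext => t /=.
  have E : (fun y => partial (lift ord0 j) f (vcons t y)) =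
           partial j (fun y => f (vcons t y)).
    by apply/funext => y; exact: partial_slice.
  rewrite E; apply: IH.
  - exact: cc_slice.
  - by move=> y; apply: derivable_slice; exact: df.
  - by rewrite -E; have [] := cc_slice t cdf.
apply: (cc1_deriv0 (cc_integral cdf)) => [t|t Mt]; first exact: is_derive_integral cf df dfc.
rewrite /= [X in integral_Rn X](_ : _ = fun=> 0) ?integral_Rn0//.
by apply/funext => y; apply: (f0 _ ord0); rewrite vcons0.
Qed.

End Divergence.

(** * Functions of class C^k and their closure properties *)

Section SmoothCalculus.
Variables (R : realType) (n : nat).
Implicit Types (f g : 'rV[R]_n -> R) (i : 'I_n) (x : 'rV[R]_n).

(** Peels off the innermost derivative, whereas [iter_partial] adds the outermost one. The product
    and chain rules then give closure by induction on [k], and having [ck k] for all [k] gives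
    [smooth]. *)
Fixpoint ck (k : nat) f : Prop :=
  continuous f /\
  if k is k'.+1 then
    forall i, (forall x, derivable f x (basis_vec R i)) /\ ck k' (partial i f)
  else True.

Lemma ck_continuous k f : ck k f -> continuous f.
Proof. by case: k => [|k] []. Qed.

Lemma ck_derivable k f i x : ck k.+1 f -> derivable f x (basis_vec R i).
Proof. by move=> [_ /(_ i)[]]. Qed.

Lemma ck_partial k f i : ck k.+1 f -> ck k (partial i f).
Proof. by move=> [_ /(_ i)[]]. Qed.

Lemma ckW k f : ck k.+1 f -> ck k f.
Proof.
elim: k f => [|k IH] f [fc df]; split=> // i.
by have [d1 d2] := df i; split=> //; exact: IH.
Qed.

Lemma ck1_of k f : ck k.+1 f -> ck 1 f.
Proof.
by move=> fk; split; [exact: ck_continuous fk|move=> i; split; [move=> x; exact: ck_derivable fk|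
  split=> //; apply: ck_continuous (ck_partial i fk)]].
Qed.

Lemma ck_smooth f : (forall k, ck k f) -> smooth f.
Proof.
move=> fk s; have {}fk k : ck k (iter_partial s f).
  elim: s k => [|i s IH] k /=; first exact: fk.
  exact: ck_partial (IH k.+1).
by split=> [|i x]; [exact: ck_continuous (fk 0)|exact: ck_derivable (fk 1)].
Qed.

Lemma smooth_ck1 f : smooth f -> ck 1 f.
Proof.
move=> sf; have [fc df] := sf [::]; split=> // i; split; first exact: df.
by have [] := sf [:: i].
Qed.

Lemma ck_cst k (c : R) : ck k (fun=> c).
Proof.
elim: k c => [|k IH] c; split; try exact: cst_continuous.
  by [].
move=> i; split=> [x|]; first exact: derivable_cst.
rewrite (_ : partial i _ = fun=> 0) //.
by apply/funext => x; exact: derive_cst.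
Qed.

Lemma continuousD_rV f g : continuous f -> continuous g ->
  continuous (fun x => f x + g x).
Proof. by move=> fc gc x; exact: (cvgD (fc x) (gc x)). Qed.

Lemma continuousM_rV f g : continuous f -> continuous g ->
  continuous (fun x => f x * g x).
Proof. by move=> fc gc x; exact: (cvgM (fc x) (gc x)). Qed.

Lemma ckD k f g : ck k f -> ck k g -> ck k (fun x => f x + g x).
Proof.
elim: k f g => [|k IH] f g fk gk.
  by split=> //; exact: continuousD_rV fk.1 gk.1.
split=> [|i]; first exact: continuousD_rV fk.1 gk.1.
split=> [x|]; first by apply: derivableD; [exact: ck_derivable fk|exact: ck_derivable gk].
rewrite (_ : partial i _ = fun x => partial i f x + partial i g x).
  by apply: IH; exact: ck_partial.
by apply/funext => x; apply: deriveD; [exact: ck_derivable fk|exact: ck_derivable gk].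
Qed.

Lemma partialD f g i x : ck 1 f -> ck 1 g ->
  partial i (fun x => f x + g x) x = partial i f x + partial i g x.
Proof.
by move=> fk gk; apply: deriveD; [exact: ck_derivable fk|exact: ck_derivable gk].
Qed.

Lemma partialM f g i x : ck 1 f -> ck 1 g ->
  partial i (fun x => f x * g x) x = f x * partial i g x + g x * partial i f x.
Proof.
by move=> fk gk; apply: deriveM; [exact: ck_derivable fk|exact: ck_derivable gk].
Qed.

Lemma ckM k f g : ck k f -> ck k g -> ck k (fun x => f x * g x).
Proof.
elim: k f g => [|k IH] f g fk gk.
  by split=> //; exact: continuousM_rV fk.1 gk.1.
split=> [|i]; first exact: continuousM_rV fk.1 gk.1.
split=> [x|]; first by apply: derivableM; [exact: ck_derivable fk|exact: ck_derivable gk].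
rewrite (_ : partial i _ = fun x => f x * partial i g x + g x * partial i f x).
  by apply: ckD; apply: IH; by [exact: ckW|exact: ck_partial].
by apply/funext => x; apply: partialM; [exact: ck1_of fk|exact: ck1_of gk].
Qed.

Lemma ckZ k (c : R) f : ck k f -> ck k (fun x => c * f x).
Proof. by apply: ckM; exact: ck_cst. Qed.

Lemma partialZ (c : R) f i x : ck 1 f ->
  partial i (fun x => c * f x) x = c * partial i f x.
Proof. by move=> fk; rewrite partialM//; [rewrite /partial derive_cst mulr0 addr0|exact: ck_cst]. Qed.

Lemma ck_sum k (I : Type) (r : seq I) (P : pred I) (F : I -> 'rV[R]_n -> R) :
  (forall j, ck k (F j)) -> ck k (fun x => \sum_(j <- r | P j) F j x).
Proof.
move=> Fk; elim: r => [|j r IH].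
  by under eq_fun do rewrite big_nil; exact: ck_cst.
under eq_fun do rewrite big_cons.
by case: (P j) => //; apply: ckD.
Qed.

Lemma partial_sum (I : Type) (r : seq I) (P : pred I) (F : I -> 'rV[R]_n -> R) i x :
  (forall j, ck 1 (F j)) ->
  partial i (fun x => \sum_(j <- r | P j) F j x) x =
  \sum_(j <- r | P j) partial i (F j) x.
Proof.
move=> Fk; elim: r => [|j r IH].
  rewrite big_nil; under eq_fun do rewrite big_nil; exact: derive_cst.
rewrite big_cons; under eq_fun do rewrite big_cons.
by case: (P j) => //; rewrite partialD ?IH//; exact: ck_sum.
Qed.

Lemma ck_prod k (I : Type) (r : seq I) (P : pred I) (F : I -> 'rV[R]_n -> R) :
  (forall j, ck k (F j)) -> ck k (fun x => \prod_(j <- r | P j) F j x).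
Proof.
move=> Fk; elim: r => [|j r IH].
  by under eq_fun do rewrite big_nil; exact: ck_cst.
under eq_fun do rewrite big_cons.
by case: (P j) => //; apply: ckM.
Qed.

Lemma partial_coord i j x : is_derive x (basis_vec R i) (fun x => x 0 j) (i == j)%:R.
Proof.
have dcv : h^-1 *: (((fun x => x 0 j) \o shift x) (h *: basis_vec R i) - x 0 j)
    @[h --> (0 : R)^'] --> ((i == j)%:R : R).
  apply: cvg_near_cst; near=> h => /=.
  have h0 : h != 0 by near: h; exact: nbhs_dnbhs_neq.
  by rewrite !mxE eqxx /= addrK [_ *: _]mulrA mulVf// mul1r eq_sym.
by apply: DeriveDef; [apply/cvg_ex; exists (i == j)%:R|apply: cvg_lim].
Unshelve. all: by end_near.
Qed.

Lemma ck_coord k j : ck k (fun x => x 0 j).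
Proof.
case: k => [|k]; first by split=> //; exact: coord_continuous.
split=> [|i]; first exact: coord_continuous.
split=> [x|]; first by have := partial_coord i j x.
rewrite (_ : partial i _ = fun=> (i == j)%:R); first exact: ck_cst.
by apply/funext => x; have [] := partial_coord i j x.
Qed.

(** Reduces directional derivatives to one variable, where the chain rule is available. *)
Lemma is_derive_line f x v (l : R) :
  is_derive x v f l <-> is_derive (0 : R) 1 (fun h : R => f (h *: v + x)) l.
Proof.
have E : (fun h : R => h^-1 *: ((f \o shift x) (h *: v) - f x)) =
  (fun h : R => h^-1 *: (((fun h => f (h *: v + x)) \o shift 0) (h *: 1) - f (0 *: v + x))).
  by apply/funext => h /=; rewrite addr0 scale0r add0r [h *: 1]mulr1.
split=> -[].
  by rewrite /derivable /derive E => d <-.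
by rewrite /derivable /derive -E => d <-.
Qed.

Lemma is_derive_comp (h : R -> R) f x v (l m : R) :
  is_derive (f x) 1 h m -> is_derive x v f l ->
  is_derive x v (fun x => h (f x)) (m * l).
Proof.
move=> dh /is_derive_line df; apply/is_derive_line.
have dh' : is_derive (f (0 *: v + x)) 1 h m by rewrite scale0r add0r.
exact: (is_derive1_comp (f := h) (g := fun h : R => f (h *: v + x))).
Qed.

Lemma partial_comp (h h' : R -> R) f i x : ck 1 f -> is_derive (f x) 1 h (h' (f x)) ->
  partial i (fun x => h (f x)) x = h' (f x) * partial i f x.
Proof.
move=> fk dh.
by have [] := is_derive_comp dh (derivableP (ck_derivable (i := i) (x := x) fk)).
Qed.

Lemma ck_comp0 (h h' : R -> R) f : (forall x, is_derive (f x) 1 h (h' (f x))) ->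
  continuous f -> continuous (fun x => h (f x)).
Proof.
move=> dh fc x; apply: continuous_comp; first exact: fc.
by apply/differentiable_continuous/derivable1_diffP; have [] := dh x.
Qed.

(** Derivatives of [h] are required only at values of [f], which admits the inverse and the
    logarithm. Regularity of [h' (f x)] is a premise, because for each [h] used below [h'] is built
    from functions already treated or from [h] itself one order lower. *)
Lemma ck_comp k (h h' : R -> R) f : (forall x, is_derive (f x) 1 h (h' (f x))) ->
  ck k.+1 f -> ck k (fun x => h' (f x)) -> ck k.+1 (fun x => h (f x)).
Proof.
move=> dh fk hk; split=> [|i]; first exact: ck_comp0 dh (ck_continuous fk).
split=> [x|].
  by have [] := is_derive_comp (dh x) (derivableP (ck_derivable (i := i) (x := x) fk)).
rewrite (_ : partial i _ = fun x => h' (f x) * partial i f x).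
  by apply: ckM => //; exact: ck_partial.
by apply/funext => x; apply: partial_comp => //; exact: ck1_of fk.
Qed.

Lemma ck_expR k f : ck k f -> ck k (fun x => expR (f x)).
Proof.
elim: k f => [|k IH] f fk.
  by split=> //; apply: ck_comp0 (ck_continuous fk) => x; exact: is_derive_expR.
by apply: (ck_comp _ fk (IH _ (ckW fk))) => x; exact: is_derive_expR.
Qed.

Lemma is_deriveV1 (t : R) : t != 0 -> is_derive t 1 (fun t => t^-1) (- (t^-1 * t^-1)).
Proof.
move=> t0.
have d : derivable (fun t : R => t^-1) t 1 by apply: derivableV.
apply: DeriveDef => //.
by rewrite deriveV// derive_id scaleNr [_ *: _]mulr1 expr2 invfM.
Qed.

Lemma ck_inv k f : (forall x, f x != 0) -> ck k f -> ck k (fun x => (f x)^-1).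
Proof.
move=> f0; elim: k f f0 => [|k IH] f f0 fk.
  split=> //; apply: (ck_comp0 (h := GRing.inv) (h' := fun t => - (t^-1 * t^-1)) (fun x => is_deriveV1 (f0 x)) fk.1).
apply: (ck_comp (h := GRing.inv) (h' := fun t => - (t^-1 * t^-1)) (fun x => is_deriveV1 (f0 x)) fk).
under eq_fun do rewrite -mulN1r.
by apply/ckZ/ckM; apply: IH => //; exact: ckW.
Qed.

Lemma ck_ln k f : (forall x, 0 < f x) -> ck k f -> ck k (fun x => ln (f x)).
Proof.
move=> f0; case: k => [|k] fk.
  split=> //; apply: ck_comp0 (ck_continuous fk) => x.
  exact: (is_derive1_ln (f0 x)).
apply: (ck_comp (h := @ln R) (h' := GRing.inv) _ fk) => [x|].
  exact: (is_derive1_ln (f0 x)).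
by apply: ck_inv; [move=> x; rewrite gt_eqF|exact: ckW].
Qed.

End SmoothCalculus.

(** * The function exp (-1/t), extended by 0, and its derivatives *)

Section FlatFunction.
Variable R : realType.
Implicit Types (t x y : R) (j k : nat).

(** The index [j] makes the span of the family stable under differentiation, so smoothness of
    [flat 0] is proved for all [j] at once. *)
Definition flat j t : R := if 0 < t then expR (- t^-1) * t^-1 ^+ j else 0.

(** With [y = 1 / x], write [expR y] as the power [k.+1] of [expR (y / k.+1)], which exceeds
    [y / k.+1]. *)
Lemma expRN_le_exp k x : 0 < x -> expR (- x^-1) <= (k.+1%:R * x) ^+ k.+1.
Proof.
move=> x0; set y := x^-1; have y0 : 0 < y by rewrite invr_gt0.
have k0 : 0 < k.+1%:R :> R by [].
have -> : k.+1%:R * x = (y / k.+1%:R)^-1 by rewrite invf_div /y invrK.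
rewrite expRN exprVn lef_pV2 ?posrE ?exprn_gt0 ?divr_gt0 ?expR_gt0//.
have -> : expR y = expR (y / k.+1%:R) ^+ k.+1.
  by rewrite -expRM_natl mulrC divfK ?gt_eqF.
apply: lerXn2r; rewrite ?nnegrE ?expR_ge0 ?divr_ge0 ?ltW//.
by apply: lt_le_trans (expR_ge1Dx _); rewrite ltrDr.
Qed.

Lemma flat_le_sqr j t : `|flat j t| <= j.+2%:R ^+ j.+2 * t ^+ 2.
Proof.
rewrite /flat; case: ifPn => t0; last first.
  by rewrite normr0 mulr_ge0 ?sqr_ge0 ?exprn_ge0.
rewrite ger0_norm; last by rewrite mulr_ge0 ?expR_ge0// exprn_ge0// invr_ge0 ltW.
have E : t ^+ j.+2 * t^-1 ^+ j = t ^+ 2.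
  by rewrite exprVn -[j.+2]add2n exprD mulfK// expf_neq0// gt_eqF.
rewrite -E mulrA -exprMn.
by rewrite ler_pM2r ?exprn_gt0 ?invr_gt0//; exact: expRN_le_exp.
Qed.

Lemma is_derive_sqr t : is_derive t 1 (fun t : R => t ^+ 2) (2 * t).
Proof.
apply: DeriveDef; first exact: exprn_derivable.
by rewrite exp_derive [_ *: _]mulr1.
Qed.

Lemma is_derive_expRN_pow j (y : R) :
  is_derive y 1 (fun y => expR (- y) * y ^+ j)
    (expR (- y) * (j%:R * y ^+ j.-1 - y ^+ j)).
Proof.
have d1 : is_derive y 1 (fun y => expR (- y)) (- expR (- y)).
  apply: (is_derive_eq (is_derive1_comp (is_derive_expR (- y)) (is_deriveNid y (1 : R)))).
  by rewrite mulrN1.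
have d2 : is_derive y 1 (fun y : R => y ^+ j) (j%:R * y ^+ j.-1).
  apply: DeriveDef; first exact: exprn_derivable.
  by rewrite exp_derive [_ *: 1]mulr1.
apply: (is_derive_eq (is_deriveM d1 d2)).
by rewrite /GRing.scale /=; ring.
Qed.

Lemma is_derive_flat j t :
  is_derive t 1 (flat j) (flat j.+2 t - j%:R * flat j.+1 t).
Proof.
have [t0|t0|<-] := ltgtP 0 t.
- have dV := is_deriveV1 (lt0r_neq0 t0).
  have dF : is_derive t 1 (fun t => expR (- t^-1) * t^-1 ^+ j)
      (flat j.+2 t - j%:R * flat j.+1 t).
    apply: (is_derive_eq (is_derive1_comp (is_derive_expRN_pow j t^-1) dV)).
    rewrite /flat t0; case: (j) => [|k] /=; rewrite ?expr0 !exprS; ring.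
  apply: near_eq_is_derive dF.
  near=> s; rewrite /flat ifT//; near: s; exact: lt_nbhsr.
- have -> : flat j.+2 t - j%:R * flat j.+1 t = 0.
    by rewrite /flat ltNge ltW//= mulr0 subr0.
  apply: near_eq_is_derive (is_derive_cst 0 t 1).
  near=> s; rewrite /flat ltNge ltW//=; near: s; exact: lt_nbhsl.
(* At 0 the quadratic bound [flat_le_sqr] makes the difference quotient at most a constant times
   [|h|]. *)
have -> : flat j.+2 0 - j%:R * flat j.+1 0 = 0 by rewrite /flat ltxx mulr0 subr0.
apply: cvg_is_derive; apply/cvgrPdist_le => e e0.
have C0 : 0 < j.+2%:R ^+ j.+2 :> R by rewrite exprn_gt0.
near=> h.
have h0 : h != 0 by near: h; exact: nbhs_dnbhs_neq.
have hd : `|h| < e / j.+2%:R ^+ j.+2.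
  by near: h; apply: dnbhs0_lt; rewrite divr_gt0.
rewrite addr0 {2}/flat ltxx sub0r subr0 normrN normrM normfV.
rewrite ler_pdivrMl ?normr_gt0//.
apply: le_trans (flat_le_sqr _ _) _.
rewrite -(real_normK (num_real h)) expr2 mulrA [leRHS]mulrC ler_wpM2r//.
by rewrite mulrC -ler_pdivlMr// ltW.
Unshelve. all: by end_near.
Qed.

Lemma ck_flat n k j (f : 'rV[R]_n -> R) : ck k f ->
  ck k (fun x : 'rV[R]_n => flat j (f x)).
Proof.
elim: k j f => [|k IH] j f fk.
  by split=> //; apply: (ck_comp0 (h := flat j) (h' := fun t => flat j.+2 t - j%:R * flat j.+1 t)
    (fun z => is_derive_flat j (f z)) fk.1).
apply: (ck_comp (h := flat j) (h' := fun t => flat j.+2 t - j%:R * flat j.+1 t)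
  (fun z => is_derive_flat j (f z)) fk).
under eq_fun do rewrite -mulNr.
by apply: ckD; [|apply: ckZ]; apply: IH; exact: ckW.
Qed.

Lemma flat_npos j t : t <= 0 -> flat j t = 0.
Proof. by move=> t0; rewrite /flat ltNge t0. Qed.

Lemma flat_gt0 j t : 0 < t -> 0 < flat j t.
Proof. by move=> t0; rewrite /flat t0 mulr_gt0 ?expR_gt0 ?exprn_gt0 ?invr_gt0. Qed.

Lemma flat_ge0 j t : 0 <= flat j t.
Proof.
by case: (ltP 0 t) => t0; [exact/ltW/flat_gt0|rewrite flat_npos].
Qed.

Lemma flat0_le1 t : flat 0 t <= 1.
Proof.
rewrite /flat; case: ifP => // t0.
by rewrite expr0 mulr1 expR_le1 oppr_le0 invr_ge0 ltW.
Qed.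

Lemma flat0_le s t : s <= t -> flat 0 s <= flat 0 t.
Proof.
move=> st; case: (ltP 0 s) => s0; last by rewrite (flat_npos _ s0) flat_ge0.
have t0 := lt_le_trans s0 st.
by rewrite /flat s0 t0 !expr0 !mulr1 ler_expR lerN2 lef_pV2.
Qed.

Lemma is_derive_flat0 t : is_derive t 1 (flat 0) (flat 2 t).
Proof. by apply: (is_derive_eq (is_derive_flat 0 t)); rewrite mul0r subr0. Qed.

(** With [y = 1 / t] this is [(1 + y) ^ 2 <= 4 exp y], which follows from
    [1 + y <= 2 (1 + y / 2) <= 2 exp (y / 2)]. The form in [1 + t] is chosen for the argument
    [t / eta - 1] of the cut-off. *)
Lemma flat2_le t : 0 < t -> flat 2 t <= 4 / (1 + t) ^+ 2.
Proof.
move=> t0; have s0 : 0 < 1 + t by rewrite addr_gt0.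
have y0 : 0 < t^-1 by rewrite invr_gt0.
rewrite ler_pdivlMr ?exprn_gt0// /flat t0 -mulrA -exprMn mulrDr mulr1 mulVf ?gt_eqF//.
rewrite expRN mulrC ler_pdivrMr ?expR_gt0//.
have -> : expR t^-1 = expR (t^-1 / 2) ^+ 2.
  by rewrite -expRM_natl mulrC divfK.
rewrite (_ : 4 = 2 ^+ 2) -?exprMn; last by ring.
by apply: lerXn2r; rewrite ?nnegrE ?mulr_ge0 ?expR_ge0//; have := expR_ge1Dx (t^-1 / 2); lra.
Qed.

Lemma flat2_le4 t : flat 2 t <= 4.
Proof.
case: (ltP 0 t) => t0; last by rewrite flat_npos.
apply: le_trans (flat2_le t0) _.
rewrite ler_pdivrMr ?exprn_gt0//; last by lra.
by rewrite ler_peMr// exprn_ege1//; lra.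
Qed.

End FlatFunction.

(** * Algebra behind the potential, with [a i] standing for [x_i ^ 2] and [q a k] for [r_k ^ 2] *)

Section RadialAlgebra.
Variables (R : realType) (S : nat -> R).
Implicit Types (a : nat -> R) (k N : nat).

Definition prevS k : R := if k is k'.+1 then S k' else 0.
Definition gam k : R := S k - prevS k.
(** The coefficient of [1 / r_k ^ 2] in [div F - |F| ^ 2]: the first term comes from [radial_div],
    the squares from [radial_sum2]. *)
Definition radial_weight k : R := gam k * (k%:R - 1) - S k ^+ 2 + prevS k ^+ 2.

Lemma sum_gam N : \sum_(k < N) gam k = prevS N.
Proof.
elim: N => [|N IH]; first by rewrite big_ord0.
by rewrite big_ord_recr /= IH /gam addrC subrK.
Qed.

Let q a k := \sum_(j < k.+1) a j.

Lemma radial_sum1 a N : (forall k, (k < N)%N -> q a k != 0) ->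
  \sum_(i < N) a i * (\sum_(k < N | (i <= k)%N) gam k / q a k) = prevS N.
Proof.
move=> q0; rewrite -sum_gam.
under eq_bigr do rewrite big_distrr /=.
rewrite (exchange_big_dep xpredT) //=; apply: eq_bigr => k _.
rewrite -big_distrl /= -(big_ord_widen N a (ltn_ord k)) -/(q a k).
by rewrite mulrC divfK ?q0.
Qed.

(** Index [N] shifts every inner sum by [gam N / q a N]. By [radial_sum1] the cross terms add up to
    [2 gam N prevS N / q a N], and with [gam N ^ 2 / q a N] they make a difference of squares. *)
Lemma radial_sum2 a N : (forall k, (k < N)%N -> q a k != 0) ->
  \sum_(i < N) a i * (\sum_(k < N | (i <= k)%N) gam k / q a k) ^+ 2 =
  \sum_(k < N) (S k ^+ 2 - prevS k ^+ 2) / q a k.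
Proof.
elim: N => [|N IH] q0; first by rewrite !big_ord0.
have q0' k : (k < N)%N -> q a k != 0 by move=> kN; apply: q0; rewrite ltnW.
have T i : (i <= N)%N -> \sum_(k < N.+1 | (i <= k)%N) gam k / q a k =
    \sum_(k < N | (i <= k)%N) gam k / q a k + gam N / q a N.
  by move=> iN; rewrite big_mkcond big_ord_recr /= iN -big_mkcond.
rewrite [LHS]big_ord_recr [RHS]big_ord_recr /= -(IH q0').
rewrite (eq_bigr (fun i : 'I_N =>
    a i * (\sum_(k < N | (i <= k)%N) gam k / q a k) ^+ 2 +
    (2 * (gam N / q a N) * (a i * (\sum_(k < N | (i <= k)%N) gam k / q a k)) +
     (gam N / q a N) ^+ 2 * a i))); last first.
  by move=> i _; rewrite T 1?ltnW//; ring.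
rewrite T// big_split big_split /= -!big_distrr /= radial_sum1//.
rewrite [\sum_(k < N | (N <= k)%N) _]big_pred0; last first.
  by move=> k; rewrite leqNgt ltn_ord.
rewrite -!addrA; congr (_ + _).
have -> : \sum_(i < N) a i = q a N - a N by rewrite /q big_ord_recr /= addrK.
have := q0 N (ltnSn N); set Q := q a N; rewrite /gam => Q0.
by field.
Qed.

(** For fixed [k], summing over [i <= k] gives [(k + 1) / q - 2 q / q ^ 2], that is
    [(k - 1) / q]. *)
Lemma radial_div a N : (forall k, (k < N)%N -> q a k != 0) ->
  \sum_(i < N) \sum_(k < N | (i <= k)%N)
     gam k * ((q a k)^-1 - 2 * a i * ((q a k)^-1 * (q a k)^-1)) =
  \sum_(k < N) gam k * (k%:R - 1) / q a k.
Proof.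
move=> q0; rewrite (exchange_big_dep xpredT) //=; apply: eq_bigr => k _.
rewrite -big_distrr /= -mulrA; congr (_ * _).
rewrite big_split /= -[X in X + _](big_ord_widen N (fun=> (q a k)^-1) (ltn_ord k)).
rewrite sumrN -big_distrl -big_distrr /= -(big_ord_widen N a (ltn_ord k)) -/(q a k).
rewrite sumr_const card_ord -[_ *+ k.+1]mulr_natl -[k.+1%:R]natr1.
have := q0 k (ltn_ord k); set Q := q a k => Q0.
by field.
Qed.

End RadialAlgebra.

(** * Regularised radii and the vector field F *)

Section HardyIdentity.
Variables (R : realType) (n : nat).
Implicit Types (x : 'rV[R]_n.+1) (u : 'rV[R]_n.+1 -> R) (i j : 'I_n.+1) (k : nat).
Implicit Types (eta M : R).

Definition radius2 k x : R := \sum_(j < n.+1 | (j <= k)%N) x 0 j ^+ 2.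

Lemma radius2_ge0 k x : 0 <= radius2 k x.
Proof. by apply: sumr_ge0 => j _; exact: sqr_ge0. Qed.

Lemma radius2_le k l x : (k <= l)%N -> radius2 k x <= radius2 l x.
Proof.
move=> kl; rewrite /radius2 [leRHS](bigID (fun j : 'I_n.+1 => (j <= k)%N)) /=.
rewrite [X in _ <= X + _](eq_bigl (fun j : 'I_n.+1 => (j <= k)%N)); last first.
  by move=> j; apply: andb_idl => jk; exact: leq_trans kl.
by rewrite lerDl sumr_ge0// => j _; exact: sqr_ge0.
Qed.

Lemma radius2_ge k x j : (j <= k)%N -> x 0 j ^+ 2 <= radius2 k x.
Proof.
move=> jk; rewrite /radius2 (bigD1 j)//= lerDl sumr_ge0// => l _; exact: sqr_ge0.
Qed.

Lemma radius2_gt0 k x : 0 < x 0 ord0 -> 0 < radius2 k x.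
Proof.
by move=> x0; apply: lt_le_trans (radius2_ge x (j := ord0) _); rewrite ?exprn_gt0.
Qed.

(* The flat term vanishes on [eta <= x_0] and makes the function positive
   everywhere, so that its inverse and logarithm are smooth on the whole space. *)
Definition reg_radius2 eta k x : R := radius2 k x + flat 0 (eta - x 0 ord0).

Lemma reg_radius2_gt0 eta k x : 0 < eta -> 0 < reg_radius2 eta k x.
Proof.
move=> eta0; rewrite /reg_radius2; have [x0|x0] := ltP 0 (x 0 ord0).
  by rewrite ltr_pwDl ?radius2_gt0 ?flat_ge0.
by rewrite ltr_wpDl ?radius2_ge0// flat_gt0; lra.
Qed.

Lemma reg_radius2E eta k x : eta <= x 0 ord0 -> reg_radius2 eta k x = radius2 k x.
Proof. by move=> ex; rewrite /reg_radius2 flat_npos ?addr0//; lra. Qed.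

Lemma ck_radius2 p k : ck p (radius2 k).
Proof.
by apply: ck_sum => j; rewrite (_ : (fun x => _) = (fun x => x 0 j * x 0 j)) //;
  apply: ckM; exact: ck_coord.
Qed.

Lemma ck_reg_radius2 p eta k : ck p (reg_radius2 eta k).
Proof.
apply: ckD; first exact: ck_radius2.
apply: ck_flat; under eq_fun do rewrite -mulN1r.
by apply: ckD; [exact: ck_cst|exact/ckZ/ck_coord].
Qed.

Lemma ck_reg_inv p eta k : 0 < eta -> ck p (fun x => (reg_radius2 eta k x)^-1).
Proof.
by move=> eta0; apply: ck_inv (ck_reg_radius2 _ _ _) => x; rewrite gt_eqF ?reg_radius2_gt0.
Qed.

Lemma partial_coordE i j x : partial i (fun x => x 0 j) x = (i == j)%:R.
Proof. by have [] := partial_coord i j x. Qed.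

Lemma partial_radius2 i k x : partial i (radius2 k) x = 2 * x 0 i * (i <= k)%:R.
Proof.
rewrite partial_sum; last first.
  move=> j; rewrite (_ : (fun x => _) = (fun x => x 0 j * x 0 j)) //.
  by apply: ckM; exact: ck_coord.
have E j : partial i (fun x => x 0 j ^+ 2) x = 2 * x 0 j * (i == j)%:R.
  rewrite (_ : (fun x => _) = (fun x => x 0 j * x 0 j)) //.
  by rewrite partialM ?partial_coordE; [ring|exact: ck_coord..].
under eq_bigr do rewrite E.
have [ik|ik] := boolP (i <= k)%N.
  rewrite (bigD1 i)//= eqxx big1 ?addr0// => j /andP[_ ji].
  by rewrite eq_sym (negbTE ji) mulr0.
rewrite mulr0 big1// => j jk; case: eqP => [ij|]; last by rewrite mulr0.
by rewrite ij jk in ik.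
Qed.

(** Valid up to the boundary [x_0 = eta] because the derivative [flat 2] of the added term also
    vanishes at 0. *)
Lemma partial_reg_radius2 eta i k x : eta <= x 0 ord0 ->
  partial i (reg_radius2 eta k) x = 2 * x 0 i * (i <= k)%:R.
Proof.
move=> ex.
have ce : ck 1 (fun x => eta - x 0 ord0).
  under eq_fun do rewrite -mulN1r.
  by apply: ckD; [exact: ck_cst|exact/ckZ/ck_coord].
rewrite partialD ?partial_radius2; [|exact: ck_radius2|exact: ck_flat].
by rewrite (partial_comp (h := flat 0) (h' := flat 2) i ce (is_derive_flat0 _))
  flat_npos ?mul0r ?addr0//; lra.
Qed.

Lemma partial_reg_inv eta i k x : 0 < eta -> eta <= x 0 ord0 ->
  partial i (fun x => (reg_radius2 eta k x)^-1) x =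
  - ((radius2 k x)^-1 * (radius2 k x)^-1) * (2 * x 0 i * (i <= k)%:R).
Proof.
move=> eta0 ex.
have f0 : reg_radius2 eta k x != 0 by rewrite gt_eqF ?reg_radius2_gt0.
rewrite (partial_comp (h := GRing.inv) (h' := fun t => - (t^-1 * t^-1)) i
  (ck_reg_radius2 1 eta k) (is_deriveV1 f0)).
by rewrite partial_reg_radius2// reg_radius2E.
Qed.

Variable S : nat -> R.

(** Component [i] of F, made smooth on the whole space; only the radii with [k >= i] depend on
    [x_i]. *)
Definition drift eta i x : R :=
  \sum_(k < n.+1 | (i <= k)%N) gam S k * (x 0 i * (reg_radius2 eta k x)^-1).

Lemma ck_drift p eta i : 0 < eta -> ck p (drift eta i).
Proof.
move=> eta0; apply: ck_sum => k; apply: ckZ; apply: ckM; first exact: ck_coord.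
exact: ck_reg_inv.
Qed.

Let sqc x (j : nat) : R := x 0 (inord j) ^+ 2.

Lemma radius2E k x : (k < n.+1)%N -> radius2 k x = \sum_(j < k.+1) sqc x j.
Proof.
move=> kn; rewrite (big_ord_widen n.+1 (sqc x) kn); apply: eq_bigr => j _.
by rewrite /sqc inord_val.
Qed.

Lemma radius2_sqc_neq0 x k : 0 < x 0 ord0 -> (k < n.+1)%N ->
  \sum_(j < k.+1) sqc x j != 0.
Proof. by move=> x0 kn; rewrite -radius2E// gt_eqF ?radius2_gt0. Qed.

Lemma drift_sqr eta x : 0 < eta -> eta <= x 0 ord0 ->
  \sum_i drift eta i x ^+ 2 =
  \sum_(k < n.+1) (S k ^+ 2 - prevS S k ^+ 2) / radius2 k x.
Proof.
move=> eta0 ex; have x0 := lt_le_trans eta0 ex.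
under [RHS]eq_bigr => k _ do rewrite radius2E//.
rewrite -(@radial_sum2 R S (sqc x)); last by move=> k; exact: radius2_sqc_neq0.
apply: eq_bigr => i _; rewrite /sqc inord_val -exprMn; congr (_ ^+ 2).
rewrite /drift big_distrr; apply: eq_bigr => k _ /=.
by rewrite reg_radius2E// radius2E// mulrCA.
Qed.

Lemma drift_div eta x : 0 < eta -> eta <= x 0 ord0 ->
  \sum_i partial i (drift eta i) x =
  \sum_(k < n.+1) gam S k * (k%:R - 1) / radius2 k x.
Proof.
move=> eta0 ex; have x0 := lt_le_trans eta0 ex.
under [RHS]eq_bigr => k _ do rewrite radius2E//.
rewrite -(@radial_div R S (sqc x)); last by move=> k; exact: radius2_sqc_neq0.
apply: eq_bigr => i _; rewrite /drift partial_sum; last first.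
  by move=> k; apply: ckZ; apply: ckM; [exact: ck_coord|exact: ck_reg_inv].
apply: eq_bigr => k ik; rewrite partialZ; last first.
  by apply: ckM; [exact: ck_coord|exact: ck_reg_inv].
rewrite partialM ?partial_coordE ?eqxx; [|exact: ck_coord|exact: ck_reg_inv].
rewrite partial_reg_inv// reg_radius2E// ik -radius2E// /sqc inord_val.
by rewrite [true%:R]mulr1n; congr (_ * _); ring.
Qed.

Lemma radial_hardy_weightE eta x : 0 < eta -> eta <= x 0 ord0 ->
  hardy_weight (fun m : 'I_n.+1 => radial_weight S m) x =
  \sum_i partial i (drift eta i) x - \sum_i drift eta i x ^+ 2.
Proof.
move=> eta0 ex; rewrite drift_div// drift_sqr// -sumrB; apply: eq_bigr => k _.
by rewrite -/(radius2 k x) /radial_weight; ring.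
Qed.

End HardyIdentity.

(** * The integrated identity for functions vanishing near the boundary *)

Section HardyInequality.
Variables (R : realType) (n : nat).
Implicit Types (x : 'rV[R]_n.+1) (u v : 'rV[R]_n.+1 -> R) (i j : 'I_n.+1) (k : nat).
Implicit Types (eta M : R) (b : 'I_n.+1 -> R).

Definition admissible eta M u :=
  [/\ 0 < eta, ck 1 u, cc M u & forall x, x 0 ord0 < eta -> u x = 0].

Lemma cc_mul m M (f g : 'rV[R]_m -> R) : continuous f -> cc M g -> cc M (fun y => f y * g y).
Proof.
move=> fc [M0 gc g0]; split=> // [|x i Mx]; first exact: continuousM_rV.
by rewrite (g0 x i)// mulr0.
Qed.

Lemma cc_sqr m M (g : 'rV[R]_m -> R) : cc M g -> cc M (fun y => g y ^+ 2).
Proof. by move=> cg; have [_ gc _] := cg; exact: cc_mul. Qed.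

Lemma admissible_partial0 eta M u i x : admissible eta M u -> x 0 ord0 < eta ->
  partial i u x = 0.
Proof.
move=> [eta0 u1 cu u0] xe; apply: partial_near0.
by have := near_coord (@open_lt R eta) xe; apply: filterS => y; exact: u0.
Qed.

Lemma cc_partial1 M u i : ck 1 u -> cc M u -> cc M (partial i u).
Proof. by move=> u1 cu; apply: cc_partial => //; have [_ /(_ i)[_ []]] := u1. Qed.

(** The weight is singular where radii vanish, but [u] is 0 there; replacing it by a smooth weight
    yields continuity of the product. *)
Lemma hardy_weight_reg eta M u b : admissible eta M u ->
  (fun x => hardy_weight b x * u x ^+ 2) =
  (fun x => (\sum_m b m * (reg_radius2 eta m x)^-1) * u x ^+ 2).
Proof.
move=> [eta0 u1 cu u0]; apply/funext => x.
have [xe|xe] := ltP (x 0 ord0) eta; first by rewrite u0// expr0n !mulr0.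
by congr (_ * _); apply: eq_bigr => m _; rewrite reg_radius2E.
Qed.

Lemma cc_hardy_weight eta M u b : admissible eta M u ->
  cc M (fun x => hardy_weight b x * u x ^+ 2).
Proof.
move=> adm; rewrite (hardy_weight_reg _ adm); have [eta0 _ cu _] := adm.
apply: cc_mul; last exact: cc_sqr.
apply: (ck_continuous (k := 0)); apply: ck_sum => m; apply: ckZ; exact: ck_reg_inv.
Qed.

Variable S : nat -> R.

Definition drift_grad eta u x : R :=
  \sum_i (partial i u x + drift S eta i x * u x) ^+ 2.

Lemma cc_drift_grad eta M u : admissible eta M u -> cc M (drift_grad eta u).
Proof.
move=> [eta0 u1 cu u0]; have [M0 _ _] := cu.
have H i : cc M (fun x => (partial i u x + drift S eta i x * u x) ^+ 2).
  apply: cc_sqr; under eq_fun do rewrite -[_ * u _]mul1r.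
  apply: cc_lin; first exact: cc_partial1.
  by apply: cc_mul => //; apply: ck_continuous (ck_drift S 0 i eta0).
exact: (integral_Rn_sum _ M0 H).1.
Qed.

Lemma grad_sq_identity eta M u x : admissible eta M u ->
  grad_sq u x =
  (hardy_weight (fun m : 'I_n.+1 => radial_weight S m) x * u x ^+ 2 + 1 * drift_grad eta u x)
   + -1 * \sum_i partial i (fun x => drift S eta i x * u x ^+ 2) x.
Proof.
move=> adm; have [eta0 u1 cu u0] := adm.
have u2 : ck 1 (fun x => u x ^+ 2) by exact: ckM.
have E i : partial i (fun x => drift S eta i x * u x ^+ 2) x =
    2 * drift S eta i x * u x * partial i u x + u x ^+ 2 * partial i (drift S eta i) x.
  rewrite partialM//; last exact: ck_drift.
  by rewrite (_ : partial i (fun x => u x ^+ 2) x = 2 * u x * partial i u x);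
    [ring|rewrite partialM//; ring].
under [X in -1 * X]eq_bigr do rewrite E.
(* Below [eta] the regularised field no longer matches the weight, but [u] and its partial
   derivatives vanish, so both sides are 0. *)
have [xe|xe] := ltP (x 0 ord0) eta.
  have pu i := admissible_partial0 i adm xe.
  rewrite /grad_sq /drift_grad u0// !big1 ?expr0n ?mulr0 ?addr0// => i _;
  by rewrite ?pu ?mulr0 ?mul0r ?addr0 ?expr0n ?mulr0.
rewrite (radial_hardy_weightE S eta0 xe) mulrBl !mulr_suml mul1r mulN1r.
rewrite /grad_sq /drift_grad -sumrB -big_split -sumrB; apply: eq_bigr => i _ /=.
by ring.
Qed.

Lemma integral_grad_sq eta M u : admissible eta M u ->
  integral_Rn (grad_sq u) =
  integral_Rn (fun x => hardy_weight (fun m : 'I_n.+1 => radial_weight S m) x * u x ^+ 2)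
  + integral_Rn (drift_grad eta u).
Proof.
move=> adm; have [eta0 u1 cu u0] := adm; have [M0 _ _] := cu.
have c1 : ck 1 (fun x => u x ^+ 2) by exact: ckM.
have ckF i : ck 1 (fun x => drift S eta i x * u x ^+ 2).
  by apply: ckM => //; exact: ck_drift.
have ccF i : cc M (fun x => drift S eta i x * u x ^+ 2).
  by apply: cc_mul; [exact: ck_continuous (ck_drift S 0 i eta0)|exact: cc_sqr].
have cdF i := cc_partial1 i (ckF i) (ccF i).
have [cd0 id0] := integral_Rn_sum (index_enum 'I_n.+1) M0 cdF.
have -> : grad_sq u = fun x =>
  (hardy_weight (fun m : 'I_n.+1 => radial_weight S m) x * u x ^+ 2 + 1 * drift_grad eta u x)
   + -1 * \sum_i partial i (fun x => drift S eta i x * u x ^+ 2) x.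
  by apply/funext => x; exact: grad_sq_identity adm.
have cw := cc_hardy_weight (fun m : 'I_n.+1 => radial_weight S m) adm.
have cg := cc_drift_grad adm.
rewrite (integral_Rn_lin _ (cc_lin 1 cw cg) cd0) (integral_Rn_lin _ cw cg) id0.
rewrite mul1r big1 ?mulr0 ?addr0// => i _.
apply: (integral_partial (ccF i)) => [x|].
  exact: ck_derivable (ckF i).
by have [_ /(_ i)[_ []]] := ckF i.
Qed.

End HardyInequality.

(** * Part (i): the remainder is a sum of squares *)

Section Sufficiency.
Variables (R : realType) (n : nat).
Implicit Types (x : 'rV[R]_n.+1) (u : 'rV[R]_n.+1 -> R).

Lemma C0inf_admissible u : C0inf_halfspace u -> exists eta M, admissible eta M u.
Proof.
move=> [su [cK Kpos]]; set K := closure _ in cK Kpos.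
have u1 := smooth_ck1 su.
have u0 x : ~ K x -> u x = 0.
  by move=> nK; apply/eqP/negP => /negP ux; apply: nK; exact: subset_closure.
have [K0|/set0P K0] := eqVneq K set0.
  have uz x : u x = 0 by apply: u0; rewrite K0.
  by exists 1, 1; split=> //; split=> //; exact: ck_continuous u1.
have c1 : {within K, continuous (fun x => x 0 ord0)}.
  exact/continuous_subspaceT/coord_continuous.
have c2 : {within K, continuous (radius2 (R := R) (n := n) n)}.
  exact: (continuous_subspaceT (ck_continuous (@ck_radius2 R n 0 n))).
have [a Ka amin] := EVT_min_rV K0 cK c1.
have [b Kb bmax] := EVT_max_rV K0 cK c2.
(* The least [x_0] on the support is positive since it is attained. As [|x_i| <= x_i ^ 2 + 1], the
   largest squared radius plus 1 bounds all coordinates. *)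
exists (a 0 ord0), (radius2 n b + 1); split=> //.
- exact/Kpos/set_mem.
- split=> [||x i Mx].
  + by rewrite ltr_wpDl ?radius2_ge0.
  + exact: ck_continuous u1.
  apply: u0 => Kx; move: Mx; apply/negP; rewrite -leNgt.
  have := bmax x (mem_set Kx); have := radius2_ge x (j := i) (k := n) (ltn_ord i).
  rewrite -(real_normK (num_real (x 0 i))); set t := `|_|; nra.
- move=> x xa; apply: u0 => Kx; move: xa; apply/negP; rewrite -leNgt.
  exact: amin (mem_set Kx).
Qed.

(* [S k = alpha_k + (k - 1) / 2] turns [radial_weight S] into the paper's beta. *)
Definition S_of (alpha : nat -> R) k : R := alpha k + (k%:R - 1) / 2.

(** The value 1/4 corresponds to a fictitious [alpha_(-1) = 0], so that both clauses of [beta_of]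
    become one formula. *)
Definition prev_sq (alpha : nat -> R) k : R :=
  if k is k'.+1 then (alpha k' - 1 / 2) ^+ 2 else 1 / 4.

Lemma radial_weight_S_of alpha k :
  radial_weight (S_of alpha) k = - alpha k ^+ 2 + prev_sq alpha k.
Proof.
rewrite /radial_weight /gam /S_of; case: k => [|k] /=; first by field.
by rewrite -natr1; field.
Qed.

Lemma beta_ofP (alpha : nat -> R) (beta : 'I_n.+1 -> R) :
  beta_of (fun i => alpha i) beta <->
  forall i, beta i = - alpha i ^+ 2 + prev_sq alpha i.
Proof.
split=> [[b0 bm] i|H].
  have [i0|] := posnP i; last first.
    by move=> i0; rewrite bm//; case: i i0 => -[//|i] i1 _ /=; rewrite inordK// ltnW.
  by rewrite (_ : i = ord0) ?b0//; exact: val_inj.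
split=> [|m m0]; first by rewrite H.
by rewrite H; case: m m0 => -[//|m] m1 _ /=; rewrite inordK// ltnW.
Qed.

Lemma hardy_of_beta (alpha beta : 'I_n.+1 -> R) : beta_of alpha beta -> hardy_ineq beta.
Proof.
move=> ab u /C0inf_admissible[eta [M adm]].
pose al (k : nat) := alpha (inord k).
have ab' : beta_of (fun i : 'I_n.+1 => al i) beta.
  by rewrite (_ : (fun i => _) = alpha)//; apply/funext => j; rewrite /al inord_val.
have bE i : beta i = radial_weight (S_of al) i.
  by rewrite radial_weight_S_of; have /beta_ofP -> := ab'.
rewrite (integral_grad_sq (S_of al) adm) -[leLHS]addr0.
rewrite (_ : beta = fun m : 'I_n.+1 => radial_weight (S_of al) m); last exact/funext.
by rewrite lerD2l integral_Rn_ge0// => x; apply: sumr_ge0 => i _; exact: sqr_ge0.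
Qed.

End Sufficiency.

(** * Upper and lower bounds for iterated integrals *)

Section IntegralBounds.
Variable R : realType.
Local Notation mu := (@lebesgue_measure R).
Implicit Types (t s : R).

(** Expresses that [h] has integral at most [I] without integrating [h] over the whole line: only
    continuous compactly supported minorants are integrated. *)
Definition upper1 (h : R -> R) (I : R) :=
  forall M g, cc1 M g -> (forall t, g t <= h t) -> Rintegral mu setT g <= I.

Lemma itv_integrable g (a b : R) : (forall t, a <= t <= b -> {for t, continuous g}) ->
  mu.-integrable `[a, b] (EFin \o g).
Proof.
move=> gc; apply: continuous_compact_integrable; first exact: segment_compact.
by apply: continuous_in_subspaceT => t; rewrite inE /= in_itv /= => /gc; exact.
Qed.

Lemma cc1_support M g (a b : R) : cc1 M g -> (forall t, ~~ (a <= t <= b) -> g t = 0) ->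
  Rintegral mu setT g = Rintegral mu `[a, b] g.
Proof.
move=> cg g0; rewrite [RHS]Rintegral_mkcond; congr Rintegral; apply/funext => t.
by rewrite patchE; case: ifPn => //; rewrite notin_setE /= in_itv /= => /negP /g0.
Qed.

(** Conditions on [G] and [dG] are confined to [[a, b]], so inverse powers, singular at 0, may serve
    as majorants; the companion lower bound admits the logarithm likewise. *)
Lemma cc1_le_antiderivative M g (G dG : R -> R) (a b : R) : a < b -> cc1 M g ->
  (forall t, ~~ (a <= t <= b) -> g t = 0) ->
  (forall t, a <= t <= b -> {for t, continuous dG}) ->
  (forall t, a <= t <= b -> is_derive t 1 G (dG t)) ->
  (forall t, a <= t <= b -> g t <= dG t) ->
  Rintegral mu setT g <= G b - G a.
Proof.
move=> ab cg g0 dGc dGP gdG; have [_ gc _] := cg.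
rewrite (cc1_support cg g0) -(FTC2_itv ab dGc dGP); apply: le_Rintegral => //.
- by apply: itv_integrable => t _; exact: gc.
- exact: itv_integrable.
Qed.

Lemma cc1_ge_antiderivative M g (G dG : R -> R) (a b : R) : a < b -> cc1 M g ->
  (forall t, 0 <= g t) ->
  (forall t, a <= t <= b -> {for t, continuous dG}) ->
  (forall t, a <= t <= b -> is_derive t 1 G (dG t)) ->
  (forall t, a <= t <= b -> dG t <= g t) ->
  G b - G a <= Rintegral mu setT g.
Proof.
move=> ab cg g0 dGc dGP gdG; have [_ gc _] := cg.
apply: le_trans (cc1_sub a b cg g0).
rewrite -(FTC2_itv ab dGc dGP); apply: le_Rintegral => //.
- exact: itv_integrable.
- by apply: itv_integrable => t _; exact: gc.
Qed.

Lemma upper1_antiderivative (h G dG : R -> R) (B : R) : continuous dG ->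
  (forall t : R, is_derive t 1 G (dG t)) -> (forall t, h t <= dG t) ->
  (forall t, `|G t| <= B) -> upper1 h (2 * B).
Proof.
move=> dGc dGP hdG GB M g cg gh; have [M0 _ g0] := cg.
apply: (@le_trans _ _ (G M - G (- M))); last first.
  by have := GB M; have := GB (- M); rewrite !ler_norml; lra.
apply: (cc1_le_antiderivative _ cg _ (fun t _ => dGc t) (fun t _ => dGP t)).
- by lra.
- by move=> t; rewrite -ler_norml -ltNge; exact: g0.
- by move=> t _; apply: le_trans (hdG t).
Qed.

Lemma upper1_scale h (I : R) M g (c : R) : 0 <= c -> upper1 h I -> cc1 M g ->
  (forall t, g t <= c * h t) -> Rintegral mu setT g <= c * I.
Proof.
move=> c0 hI cg gh; have [M0 gc g0] := cg.
have cst0 : cc1 M (fun=> 0 : R) by split=> //; exact: cst_continuous.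
have [cz|cnz] := eqVneq c 0.
  have := cc1_le cg cst0; rewrite cz mul0r Rintegral_cst// mul0r; apply=> t.
  by have := gh t; rewrite cz mul0r.
have cpos : 0 < c by rewrite lt_neqAle eq_sym cnz.
have cg' : cc1 M (fun t => c^-1 * g t).
  split=> // [t|t Mt]; last by rewrite g0// mulr0.
  exact: (cvgM (cvg_cst c^-1) (gc t)).
have := hI _ _ cg'; rewrite RintegralZl// ?ler_pdivrMl//; last exact: cc1_integrable cg.
by apply=> t; rewrite ler_pdivrMl.
Qed.

(** The coordinates separate: on the slice at [t] the factor [h ord0 t] is absorbed into the
    constant [A], and induction handles the others. *)
Lemma integral_Rn_upper n M (f : 'rV[R]_n -> R) (h : 'I_n -> R -> R) (I : 'I_n -> R) (A : R) :
  0 <= A -> (forall i t, 0 <= h i t) -> (forall i, 0 <= I i) ->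
  (forall i, upper1 (h i) (I i)) -> cc M f ->
  (forall y, f y <= A * \prod_i h i (y 0 i)) -> integral_Rn f <= A * \prod_i I i.
Proof.
elim: n A f h I => [|n IH] A f h I A0 h0 I0 hI cf fA /=.
  by have := fA 0; rewrite !big_ord0.
rewrite big_ord_recl mulrCA mulrC.
apply: (upper1_scale _ (hI ord0) (cc_integral cf)) => [|t].
  by rewrite mulr_ge0// prodr_ge0.
rewrite mulrAC; apply: (IH (A * h ord0 t) _ (fun i => h (lift ord0 i))) => //.
- by rewrite mulr_ge0.
- exact: cc_slice.
move=> y; have := fA (vcons t y); rewrite big_ord_recl vcons0 mulrA.
rewrite (eq_bigr (fun i => h (lift ord0 i) (y 0 i)))// => i _.
by rewrite vconsS.
Qed.

Lemma integral_Rn_lower n M (f : 'rV[R]_n -> R) (a b : 'I_n -> R) (A : R) :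
  0 <= A -> (forall i, a i < b i) -> cc M f -> (forall y, 0 <= f y) ->
  (forall y : 'rV[R]_n, (forall i, a i <= y 0 i <= b i) -> A <= f y) ->
  A * \prod_i (b i - a i) <= integral_Rn f.
Proof.
elim: n A f a b => [|n IH] A f a b A0 ab cf f0 fA /=.
  by rewrite big_ord0 mulr1; apply: fA => -[].
rewrite big_ord_recl mulrCA mulrC; set P := \prod_i _.
rewrite mulrBr.
apply: (cc1_ge_antiderivative (G := fun t => A * P * t) (dG := fun=> A * P)
  (ab ord0) (cc_integral cf)) => [t|t _|t _|t tab].
- exact: integral_Rn_ge0.
- exact: cst_continuous.
- by apply: is_derive_eq; rewrite [LHS]mulr1.
apply: (IH _ _ (fun i => a (lift ord0 i)) (fun i => b (lift ord0 i))) => //.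
  exact: cc_slice.
move=> y yab; apply: fA => i; case: (unliftP ord0 i) => [j|] ->.
  by rewrite vconsS.
by rewrite vcons0.
Qed.

End IntegralBounds.

(** * The one-dimensional kernel integral *)

Section Kernel.
Variable R : realType.
Implicit Types (t xi sg : R).

(** The power [(xi ^ 2 + t ^ 2) ^ (- 1/2 - sg)]; the excess [sg] makes it integrable at infinity. *)
Definition kernel_pow xi sg t : R := expR (- (2^-1 + sg) * ln (xi ^+ 2 + t ^+ 2)).

Lemma is_derive_sqrD xi t : is_derive t 1 (fun t => xi ^+ 2 + t ^+ 2) (2 * t).
Proof.
apply: (is_derive_eq (is_deriveD (is_derive_cst (xi ^+ 2) t 1) (is_derive_sqr t))).
by rewrite add0r.
Qed.

Lemma is_derive_sqr_pow xi c t : 0 < xi ->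
  is_derive t 1 (fun t => expR (c * ln (xi ^+ 2 + t ^+ 2)))
    (expR (c * ln (xi ^+ 2 + t ^+ 2)) * (c * (2 * t / (xi ^+ 2 + t ^+ 2)))).
Proof.
move=> xi0; have Q0 : 0 < xi ^+ 2 + t ^+ 2 by rewrite ltr_pwDl ?exprn_gt0 ?sqr_ge0.
have dL := @is_derive1_comp R (@ln R) (fun t => xi ^+ 2 + t ^+ 2) t _ _
  (is_derive1_ln Q0) (is_derive_sqrD xi t).
have dcL := is_deriveZ c dL.
apply: (is_derive_eq (@is_derive1_comp R expR (fun t => c * ln (xi ^+ 2 + t ^+ 2)) t _ _
  (is_derive_expR _) dcL)).
by rewrite /= /GRing.scale /=; ring.
Qed.

(* With [r ^ 2 = xi ^ 2 + t ^ 2], the kernel is dominated by the derivative of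
   [t / r * (2 xi ^ (- 2 sg) - r ^ (- 2 sg)) / (2 sg)]. *)
Lemma upper1_kernel_pow xi sg : 0 < xi -> 0 < sg <= 2^-1 ->
  upper1 (kernel_pow xi sg) (2 * (expR (- sg * ln (xi ^+ 2)) / sg)).
Proof.
move=> xi0 /andP[sg0 sg1].
pose E1 t : R := expR (- 2^-1 * ln (xi ^+ 2 + t ^+ 2)).
pose E2 t : R := expR (- sg * ln (xi ^+ 2 + t ^+ 2)).
pose K := expR (- sg * ln (xi ^+ 2)).
pose Q t : R := xi ^+ 2 + t ^+ 2.
have Q0 t : 0 < Q t by rewrite ltr_pwDl ?exprn_gt0 ?sqr_ge0.
pose V t := t * t * (Q t)^-1.
pose G t := (2 * sg)^-1 * (t * E1 t * (2 * K - E2 t)).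
pose dG t := (2 * sg)^-1 * (E1 t * (2 * K - E2 t) * (1 - V t) + 2 * sg * V t * E1 t * E2 t).
have dE1 t : is_derive t 1 E1 (E1 t * (- 2^-1 * (2 * t / Q t))).
  exact: is_derive_sqr_pow.
have dE2 t : is_derive t 1 E2 (E2 t * (- sg * (2 * t / Q t))).
  exact: is_derive_sqr_pow.
have dQV t : is_derive t 1 (fun t => (Q t)^-1) (- ((Q t)^-1 * (Q t)^-1) * (2 * t)).
  exact: (@is_derive1_comp R GRing.inv Q t _ _ (is_deriveV1 (lt0r_neq0 (Q0 t)))
    (is_derive_sqrD xi t)).
have d2K t := is_deriveB (is_derive_cst (2 * K) t 1) (dE2 t).
have did t := is_derive_id t (1 : R).
have dGP t : is_derive t 1 G (dG t).
  have d := is_deriveZ (2 * sg)^-1 (is_deriveM (is_deriveM (did t) (dE1 t)) (d2K t)).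
  apply: (is_derive_eq d); rewrite /dG /V /= /GRing.scale /=.
  have := Q0 t; set q := Q t => q0.
  rewrite (_ : (id * E1)%R t = t * E1 t)// (_ : (cst (2 * K) - E2)%R t = 2 * K - E2 t)//.
  by field; rewrite !gt_eqF.
have cE1 : continuous E1.
  by move=> t; apply/differentiable_continuous/derivable1_diffP; have [] := dE1 t.
have cE2 : continuous E2.
  by move=> t; apply/differentiable_continuous/derivable1_diffP; have [] := dE2 t.
have cV : continuous V.
  move=> t; apply/differentiable_continuous/derivable1_diffP.
  by have [] := is_deriveM (is_deriveM (did t) (did t)) (dQV t).
have cdG : continuous dG.
  move=> t; apply: (cvgM (cvg_cst _)); apply: cvgD.
    exact: (cvgM (cvgM (cE1 t) (cvgB (cvg_cst _) (cE2 t))) (cvgB (cvg_cst _) (cV t))).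
  exact: (cvgM (cvgM (cvgM (cvg_cst _) (cV t)) (cE1 t)) (cE2 t)).
have E2K t : E2 t <= K.
  by rewrite ler_expR !mulNr lerN2 ler_pM2l// ler_ln ?posrE ?exprn_gt0 ?Q0// lerDl sqr_ge0.
have E10 t : 0 < E1 t by exact: expR_gt0.
have E20 t : 0 < E2 t by exact: expR_gt0.
have V01 t : 0 <= V t <= 1.
  rewrite /V -expr2; apply/andP; split; first by rewrite divr_ge0 ?sqr_ge0 ?ltW.
  by rewrite ler_pdivrMr// mul1r lerDr sqr_ge0.
apply: (upper1_antiderivative cdG dGP) => t.
  have -> : kernel_pow xi sg t = (2 * sg)^-1 * (2 * sg * (E1 t * E2 t)).
    rewrite mulKf; last by rewrite mulf_neq0// gt_eqF.
    by rewrite -expRD -mulrDl -opprD.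
  rewrite ler_pM2l ?invr_gt0 ?mulr_gt0//.
  have -> : E1 t * (2 * K - E2 t) * (1 - V t) + 2 * sg * V t * E1 t * E2 t =
    E1 t * ((2 * K - E2 t) * (1 - V t) + 2 * sg * V t * E2 t) by ring.
  rewrite mulrCA ler_pM2l//.
  have ? := E2K t; have ? := E20 t; have /andP[? ?] := V01 t.
  (* After division by [E1], right side minus left side is the sum of this product and the next one;
     the next one uses [sg <= 1/2]. *)
  have : 0 <= (2 * K - 2 * E2 t) * (1 - V t) by apply: mulr_ge0; lra.
  have : 0 <= (1 - 2 * sg) * (1 - V t) * E2 t by apply: mulr_ge0; [apply: mulr_ge0; lra|lra].
  lra.
have tE1 : `|t * E1 t| <= 1.
  rewrite normrM (gtr0_norm (E10 t)) -(ler_pXn2r (n := 2)) ?nnegrE ?mulr_ge0 ?(ltW (E10 t))//.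
  rewrite expr1n exprMn (real_normK (num_real t)).
  have -> : E1 t ^+ 2 = (Q t)^-1.
    rewrite expr2 -expRD -mulrDl (_ : - 2^-1 + - 2^-1 = -1); last by field.
    by rewrite mulN1r expRN lnK ?posrE ?Q0.
  by have /andP[] := V01 t; rewrite /V -expr2.
rewrite /G normrM (_ : `|(2 * sg)^-1| = (2 * sg)^-1); last by rewrite gtr0_norm ?invr_gt0 ?mulr_gt0.
rewrite normrM -/K (_ : K / sg = (2 * sg)^-1 * (1 * (2 * K))); last by field; rewrite gt_eqF.
rewrite ler_pM2l ?invr_gt0 ?mulr_gt0//; apply: ler_pM => //.
rewrite ger0_norm; have := E2K t; have := E20 t; lra.
Qed.

End Kernel.

(** * Cut-off factors and their derivatives *)

Section TestFunction.
Variables (R : realType) (n : nat).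
Implicit Types (x : 'rV[R]_n.+1) (u : 'rV[R]_n.+1 -> R) (i : 'I_n.+1) (j k : nat).
Implicit Types (eta t : R).

Lemma cc_C0inf eta M u : 0 < eta -> (forall k, ck k u) -> cc M u ->
  (forall x, x 0 ord0 < eta -> u x = 0) -> C0inf_halfspace u.
Proof.
move=> eta0 uk [M0 uc uM] u0; split; first exact: ck_smooth.
pose lo i := if i == ord0 then eta else - M.
pose A := [set x : 'rV[R]_n.+1 | forall i, `[lo i, M]%classic (x ord0 i)].
have cA : compact A.
  apply: (@rV_compact R n.+1 (fun i => `[lo i, M]%classic)) => i.
  exact: segment_compact.
have clA : closed A by apply: compact_closed => //; exact: norm_hausdorff.
have sub : closure [set x | u x != 0] `<=` A.
  have -> : A = closure A by exact/closure_id.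
  apply: closure_subset => x /= ux i /=.
  have xM : `|x ord0 i| <= M.
    by rewrite leNgt; apply/negP => /uM ux0; rewrite ux0 eqxx in ux.
  rewrite in_itv /=; move: xM; rewrite ler_norml => /andP[xM1 xM2].
  rewrite xM2 andbT /lo; case: eqP => // ->.
  by rewrite leNgt; apply/negP => /u0 ux0; rewrite ux0 eqxx in ux.
split; first exact: subclosed_compact (@closed_closure _ _) cA sub.
by move=> x /sub/(_ ord0) /=; rewrite /lo eqxx in_itv /= => /andP[+ _]; exact: lt_le_trans.
Qed.

Variable m : nat.

(** For [j > m] a unit neighbourhood of 3 keeps [x_j >= 2], hence [r_j] away from 0: those terms of
    the weight stay bounded. *)
Definition center j : R := if (j <= m)%N then 0 else 3.

(** No plateau is built: the factor in [t / eta] only tends to 1. Its derivative decays like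
    [eta / t ^ 2], which is enough for the remainder to be bounded. *)
Definition cut eta j t : R :=
  if j == 0 then flat 0 (eta^-1 * t - 1) * flat 0 (1 - t)
  else flat 0 (1 - (t - center j) ^+ 2).

Definition dcut eta j t : R :=
  if j == 0 then eta^-1 * flat 2 (eta^-1 * t - 1) * flat 0 (1 - t)
                 - flat 0 (eta^-1 * t - 1) * flat 2 (1 - t)
  else - (2 * (t - center j)) * flat 2 (1 - (t - center j) ^+ 2).

Lemma is_derive_cut eta j t : is_derive t 1 (cut eta j) (dcut eta j t).
Proof.
have did := is_derive_id t (1 : R).
rewrite /cut /dcut; case: eqP => _.
  have dA : is_derive t 1 (fun t => eta^-1 * t - 1) eta^-1.
    apply: (is_derive_eq (is_deriveB (is_deriveZ eta^-1 did) (is_derive_cst (1 : R) t 1))).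
    by rewrite subr0 [LHS]mulr1.
  have dB : is_derive t 1 (fun t => 1 - t) (-1).
    apply: (is_derive_eq (is_deriveB (is_derive_cst (1 : R) t 1) did)).
    by rewrite sub0r.
  have d1 := @is_derive1_comp R (flat 0) (fun t => eta^-1 * t - 1) t _ _ (is_derive_flat0 _) dA.
  have d2 := @is_derive1_comp R (flat 0) (fun t => 1 - t) t _ _ (is_derive_flat0 _) dB.
  by apply: (is_derive_eq (is_deriveM d1 d2)); rewrite /= /GRing.scale /=; ring.
have dA : is_derive t 1 (fun t => t - center j) 1.
  apply: (is_derive_eq (is_deriveB did (is_derive_cst (center j) t 1))).
  by rewrite subr0.
have dB : is_derive t 1 (fun t => 1 - (t - center j) ^+ 2) (- (2 * (t - center j))).
  apply: (is_derive_eq (is_deriveB (is_derive_cst (1 : R) t 1) (is_deriveM dA dA))).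
  by rewrite sub0r /GRing.scale /=; ring.
apply: (is_derive_eq (@is_derive1_comp R (flat 0) (fun t => 1 - (t - center j) ^+ 2) t _ _
  (is_derive_flat0 _) dB)).
by rewrite mulrC.
Qed.

Lemma ck_cut p eta i : ck p (fun x => cut eta i (x 0 i)).
Proof.
have cc := @ck_coord R n.+1 p i.
have cst c := @ck_cst R n.+1 p c.
rewrite /cut; case: eqP => _.
  apply: ckM; apply: ck_flat.
    by apply: ckD => //; apply: ckZ.
  by under eq_fun do rewrite -mulN1r; apply: ckD => //; apply: ckZ.
apply: ck_flat; under eq_fun do rewrite -mulN1r; apply: ckD => //; apply: ckZ.
by apply: ckM; apply: ckD.
Qed.

Lemma cut_ge0 eta j t : 0 <= cut eta j t.
Proof. by rewrite /cut; case: eqP; rewrite ?mulr_ge0 ?flat_ge0. Qed.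

Lemma cut_le1 eta j t : cut eta j t <= 1.
Proof.
rewrite /cut; case: eqP => _; last exact: flat0_le1.
by rewrite mulr_ile1 ?flat_ge0 ?flat0_le1.
Qed.

Definition cut_dom eta j t :=
  if j == 0 then eta <= t <= 1 else `|t - center j| <= 1.

Lemma cut_out eta j t : 0 < eta -> ~~ cut_dom eta j t -> cut eta j t = 0 /\ dcut eta j t = 0.
Proof.
move=> eta0; rewrite /cut_dom /cut /dcut; case: eqP => _.
  rewrite negb_and -!ltNge => /orP[te|t1].
    have t0 : eta^-1 * t - 1 <= 0 by rewrite subr_le0 ler_pdivrMl// mulr1 ltW.
    by rewrite !(flat_npos _ t0) !mul0r mulr0 mul0r subrr.
  have t0 : 1 - t <= 0 by lra.
  by rewrite !(flat_npos _ t0) !mulr0 subrr.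
rewrite -ltNge => h.
have t0 : 1 - (t - center j) ^+ 2 <= 0.
  by rewrite -(real_normK (num_real (t - center j))) subr_le0 exprn_ege1// ltW.
by rewrite !(flat_npos _ t0) mulr0.
Qed.

Lemma dcut_bound eta j t : 0 < eta -> (0 < j)%N -> `|dcut eta j t| <= 8.
Proof.
move=> eta0 j0; have [td|td] := boolP (cut_dom eta j t); last first.
  by rewrite (cut_out eta0 td).2 normr0.
move: td; rewrite /cut_dom /dcut gtn_eqF// => td.
rewrite normrM normrN normrM (ger0_norm (flat_ge0 _ _)) (ger0_norm (_ : 0 <= 2))//.
have := flat2_le4 (1 - (t - center j) ^+ 2); have := flat_ge0 2 (1 - (t - center j) ^+ 2).
by have := normr_ge0 (t - center j); nra.
Qed.

(** [flat2_le] at [t / eta - 1] bounds the first term of [dcut] by [4 eta / t ^ 2], and the second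
    is at most 4; then [(p - q) ^ 2 <= 2 (p ^ 2 + q ^ 2)] gives [32 = 2 * 16]. *)
Lemma dcut0_bound eta t : 0 < eta -> eta <= t ->
  dcut eta 0 t ^+ 2 <= 32 * (eta ^+ 2 / t ^+ 4 + 1).
Proof.
move=> eta0 et; have t0 := lt_le_trans eta0 et.
rewrite /dcut /=.
set a := flat 2 (eta^-1 * t - 1); set b := flat 0 (1 - t).
set c := flat 0 (eta^-1 * t - 1); set d := flat 2 (1 - t).
have [b0 c0] : 0 <= b <= 1 /\ 0 <= c <= 1 by rewrite !flat_ge0 !flat0_le1.
have d0 : 0 <= d <= 4 by rewrite flat_ge0 flat2_le4.
have a0 : 0 <= a by exact: flat_ge0.
have a4 : eta^-1 * a <= 4 * (eta / t ^+ 2).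
  have [s0|s0] := ltP 0 (eta^-1 * t - 1); last first.
    rewrite /a flat_npos// mulr0; apply: mulr_ge0 => //.
    by rewrite divr_ge0 ?exprn_ge0 ?ltW.
  have := flat2_le s0; rewrite -/a addrC subrK => h.
  rewrite ler_pdivrMl//; apply: le_trans h _.
  rewrite le_eqVlt; apply/orP; left; apply/eqP.
  by field; rewrite !gt_eqF.
have ab0 : 0 <= eta^-1 * a * b by rewrite !mulr_ge0 ?invr_ge0 ?(ltW eta0)//; case/andP: b0.
have ab : eta^-1 * a * b <= 4 * (eta / t ^+ 2).
  apply: le_trans a4; rewrite ler_piMr//; last by case/andP: b0.
  by rewrite mulr_ge0// invr_ge0 ltW.
have cd : 0 <= c * d <= 4 by nra.
have -> : eta ^+ 2 / t ^+ 4 = (eta / t ^+ 2) ^+ 2 by field; rewrite gt_eqF.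
move: ab0 ab cd; set p := _ * b; set q := c * d; set r := eta / _ => p0 pr /andP[q0 q4].
have : (p - q) ^+ 2 <= 2 * (p ^+ 2 + q ^+ 2) by have := sqr_ge0 (p + q); lra.
have : p ^+ 2 <= (4 * r) ^+ 2 by apply: lerXn2r => //; rewrite nnegrE//; lra.
have : q ^+ 2 <= 4 ^+ 2 by apply: lerXn2r => //; rewrite nnegrE.
lra.
Qed.

End TestFunction.

(** * Critical exponents and Abel summation *)

Section CriticalExponents.
Variables (R : realType) (alpha : nat -> R) (m : nat).
Implicit Types (L : nat -> R) (k N : nat).

(* [S_of alpha] with [alpha_m] replaced by 0, kept constant beyond [m]: the radial
   weight is then critical at index [m] and vanishes beyond it. *)
Definition S_cut k : R := if (k < m)%N then S_of alpha k else (m%:R - 1) / 2.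

Lemma gam_cut0 k : (m < k)%N -> gam S_cut k = 0.
Proof.
case: k => // k; rewrite ltnS => mk.
by rewrite /gam /= /S_cut !ltnNge (leqW mk) mk /= subrr.
Qed.

Lemma radial_weight_cut k :
  radial_weight S_cut k =
  if (k < m)%N then - alpha k ^+ 2 + prev_sq alpha k
  else if k == m then prev_sq alpha m else 0.
Proof.
case: ltnP => [km|mk].
  rewrite -radial_weight_S_of /radial_weight /gam /S_cut km.
  by case: k km => [|k] km //=; rewrite (ltnW km).
case: eqP => [->|/eqP km].
  rewrite /radial_weight /gam /S_cut ltnn /prev_sq /S_of; case: (m) => [|l] /=; first by field.
  by rewrite ltnSn -natr1; field.
have {mk km}: (m < k)%N by rewrite ltn_neqAle eq_sym km.
move=> mk; rewrite /radial_weight gam_cut0// mul0r sub0r.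
case: k mk => // k; rewrite ltnS => mk.
by rewrite /= /S_cut !ltnNge (leqW mk) mk /= addNr.
Qed.

Lemma sum_gam_abel (S L : nat -> R) N :
  \sum_(k < N.+1) gam S k * L k = S N * L N - \sum_(k < N) S k * (L k.+1 - L k).
Proof.
elim: N => [|N IH]; first by rewrite big_ord_recr !big_ord0 /= /gam /=; ring.
by rewrite big_ord_recr /= IH big_ord_recr /= /gam /=; ring.
Qed.

Lemma sum_half_abel L N :
  \sum_(k < N) (k%:R - 1) / 2 * (L k.+1 - L k) - (N%:R - 1) / 2 * L N =
  L 0 / 2 - 2^-1 * \sum_(k < N) L k.+1.
Proof.
elim: N => [|N IH]; first by rewrite !big_ord0; field.
rewrite !big_ord_recr /= -natr1.
have -> : \sum_(k < N) (k%:R - 1) / 2 * (L k.+1 - L k) =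
  L 0 / 2 - 2^-1 * \sum_(k < N) L k.+1 + (N%:R - 1) / 2 * L N by rewrite -IH; ring.
by field.
Qed.

(** Abel summation replaces [gam] by [S] times increments of the nondecreasing [L]. The part
    [(k - 1) / 2] of [S] evaluates exactly by [sum_half_abel]. The part [alpha] yields at most
    [- m sg (L m - L 0)], which is distributed over the [m] radii using [L k.+1 <= L m]. *)
Lemma sum_gam_cut_upper L (sg : R) : 0 <= sg ->
  (forall k, (k < m)%N -> alpha k <= - (m%:R * sg)) ->
  (forall k l, (k <= l)%N -> L k <= L l) ->
  - \sum_(k < m.+1) gam S_cut k * L k <=
  (2^-1 + m%:R * sg) * L 0 - (2^-1 + sg) * \sum_(k < m) L k.+1.
Proof.
move=> sg0 al Lm; rewrite sum_gam_abel {1}/S_cut ltnn.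
have -> : \sum_(k < m) S_cut k * (L k.+1 - L k) =
  \sum_(k < m) (k%:R - 1) / 2 * (L k.+1 - L k) + \sum_(k < m) alpha k * (L k.+1 - L k).
  rewrite -big_split; apply: eq_bigr => k _ /=.
  by rewrite /S_cut ltn_ord /S_of; ring.
have h1 : \sum_(k < m) alpha k * (L k.+1 - L k) <= - (m%:R * sg) * (L m - L 0).
  have -> : L m - L 0 = \sum_(k < m) (L k.+1 - L k).
    by rewrite -(big_mkord xpredT (fun k => L k.+1 - L k)) telescope_sumr.
  rewrite big_distrr /=; apply: ler_sum => k _.
  by rewrite ler_wpM2r ?al// subr_ge0 Lm.
have h2 : sg * (\sum_(k < m) L k.+1 - m%:R * L 0) <= m%:R * sg * (L m - L 0).
  rewrite [m%:R * sg]mulrC -mulrA ler_wpM2l// mulrBr lerD2r.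
  have -> : m%:R * L m = \sum_(k < m) L m by rewrite sumr_const card_ord mulr_natl.
  apply: ler_sum => k _.
  by rewrite Lm.
have := sum_half_abel L m; lra.
Qed.

(** If all [L k] equalled [l], the sum would telescope to [S_cut m * l]; the spread [lam] costs at
    most [|gam|] per index. *)
Lemma sum_gam_cut_lower L (l lam : R) n : (m <= n)%N ->
  (forall k, (k <= m)%N -> l <= L k <= l + lam) ->
  \sum_(k < n.+1) gam S_cut k * L k <=
  (m%:R - 1) / 2 * l + (\sum_(k < n.+1) `|gam S_cut k|) * lam.
Proof.
move=> mn Ll.
have -> : (m%:R - 1) / 2 = \sum_(k < n.+1) gam S_cut k.
  by rewrite sum_gam /= /S_cut ltnNge mn.
rewrite !big_distrl -big_split /=; apply: ler_sum => k _.
have [km|mk] := leqP k m; last by rewrite gam_cut0// normr0 !mul0r addr0.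
have -> : gam S_cut k * L k = gam S_cut k * l + gam S_cut k * (L k - l) by ring.
rewrite lerD2l; have /andP[L1 L2] := Ll k km.
apply: (@le_trans _ _ (`|gam S_cut k| * (L k - l))).
  by rewrite ler_wpM2r ?ler_norm//; lra.
by rewrite ler_wpM2l//; lra.
Qed.

End CriticalExponents.

(** * The test functions [phi v] *)

Section TestFamily.
Variables (R : realType) (n m : nat) (S : nat -> R).
Implicit Types (x : 'rV[R]_n.+1) (i j : 'I_n.+1) (k : nat) (eta t : R).

Definition lphi eta x : R :=
  \sum_(k < n.+1) - (gam S k / 2) * ln (reg_radius2 eta k x).

Definition testv eta x : R := \prod_(j < n.+1) cut m eta j (x 0 j).

Definition testu eta x : R := expR (lphi eta x) * testv eta x.

Definition test_dom eta x := [forall j : 'I_n.+1, cut_dom m eta j (x 0 j)].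

Lemma ck_lphi p eta : 0 < eta -> ck p (lphi eta).
Proof.
move=> eta0; apply: ck_sum => k; apply: ckZ; apply: ck_ln; last exact: ck_reg_radius2.
by move=> x; exact: reg_radius2_gt0.
Qed.

Lemma ck_testv p eta : ck p (testv eta).
Proof. by apply: ck_prod => j; exact: ck_cut. Qed.

Lemma ck_testu p eta : 0 < eta -> ck p (testu eta).
Proof. by move=> eta0; apply: ckM (ck_testv _ _); apply/ck_expR/ck_lphi. Qed.

Lemma testv_ge0 eta x : 0 <= testv eta x.
Proof. by apply: prodr_ge0 => j _; exact: cut_ge0. Qed.

Lemma testv_le1 eta x : testv eta x <= 1.
Proof. by apply: prodr_ile1 => j _; rewrite cut_ge0 cut_le1. Qed.

Lemma testv_out eta x : 0 < eta -> ~~ test_dom eta x -> testv eta x = 0.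
Proof.
move=> eta0 /forallPn[j nj]; rewrite /testv (bigD1 j)//=.
by rewrite (cut_out eta0 nj).1 mul0r.
Qed.

Lemma test_dom0 eta x : test_dom eta x -> eta <= x 0 ord0 <= 1.
Proof. by move=> /forallP/(_ ord0). Qed.

Lemma test_dom_le eta x i : 0 < eta -> test_dom eta x -> `|x 0 i| <= 5.
Proof.
move=> eta0 /forallP/(_ i); rewrite /cut_dom; case: eqP => _.
  by move=> /andP[h1 h2]; rewrite ger0_norm; lra.
rewrite /center; case: ifP => _; rewrite !ler_norml; lra.
Qed.

Lemma cc_testu eta : 0 < eta -> cc 5 (testu eta).
Proof.
move=> eta0; split=> // [|x i xi]; first exact: ck_continuous (ck_testu 0 eta0).
rewrite /testu testv_out ?mulr0//; apply/negP => /(test_dom_le i eta0).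
by rewrite leNgt xi.
Qed.

Lemma testu_eq0 eta x : 0 < eta -> x 0 ord0 < eta -> testu eta x = 0.
Proof.
move=> eta0 xe; rewrite /testu testv_out ?mulr0//; apply/negP => /test_dom0.
by rewrite leNgt xe.
Qed.

Lemma testu_admissible eta : 0 < eta -> admissible eta 5 (testu eta).
Proof.
move=> eta0; split=> //; [exact: ck_testu|exact: cc_testu|].
by move=> x; exact: testu_eq0.
Qed.

Lemma testu_C0inf eta : 0 < eta -> C0inf_halfspace (testu eta).
Proof.
move=> eta0; apply: (cc_C0inf eta0 _ (cc_testu eta0)) => [k|x].
  exact: ck_testu.
exact: testu_eq0.
Qed.

Lemma partial_testv eta i x :
  partial i (testv eta) x = dcut m eta i (x 0 i) * \prod_(j | j != i) cut m eta j (x 0 j).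
Proof.
have dline : is_derive x (basis_vec R i) (testv eta)
    (dcut m eta i (x 0 i) * \prod_(j | j != i) cut m eta j (x 0 j)).
  apply/is_derive_line.
  have -> : (fun h : R => testv eta (h *: basis_vec R i + x)) =
      (fun h => cut m eta i (h + x 0 i) * \prod_(j | j != i) cut m eta j (x 0 j)).
    apply/funext => h; rewrite /testv (bigD1 i)//=.
    rewrite !mxE !eqxx mulr1; congr (_ * _); apply: eq_bigr => j ji.
    by rewrite !mxE eqxx (negbTE ji) mulr0 add0r.
  have d0 : is_derive (0 : R) 1 (fun h => h + x 0 i) 1.
    apply: (is_derive_eq (is_deriveD (is_derive_id (0 : R) (1 : R)) (is_derive_cst (x 0 i) (0 : R) (1 : R)))).
    by rewrite addr0.
  have dc : is_derive (0 + x 0 i) 1 (cut m eta i) (dcut m eta i (x 0 i)).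
    by rewrite add0r; exact: is_derive_cut.
  have d1 := @is_derive1_comp R (cut m eta i) (fun h => h + x 0 i) 0 _ _ dc d0.
  apply: (is_derive_eq (is_deriveM d1 (is_derive_cst (\prod_(j | j != i) cut m eta j (x 0 j)) (0 : R) (1 : R)))).
  by rewrite /= /GRing.scale /=; ring.
by have [] := dline.
Qed.

(** All other factors are at most 1, so [dcut] alone counts: 32 from [dcut0_bound], and [64 = 8 ^ 2]
    from [dcut_bound] for each of the [n] remaining coordinates. *)
Lemma sum_partial_testv eta x : 0 < eta -> eta <= x 0 ord0 ->
  \sum_i partial i (testv eta) x ^+ 2 <=
  (32 + 64 * n%:R) * (eta ^+ 2 / x 0 ord0 ^+ 4 + 1).
Proof.
move=> eta0 ex; have x0 := lt_le_trans eta0 ex.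
have P01 i : 0 <= \prod_(j | j != i) cut m eta j (x 0 j) <= 1.
  rewrite prodr_ge0 /=; last by move=> j _; exact: cut_ge0.
  by apply: prodr_ile1 => j _; rewrite cut_ge0 cut_le1.
have r0 : 0 <= eta ^+ 2 / x 0 ord0 ^+ 4 by rewrite divr_ge0 ?exprn_ge0 ?ltW.
have le_d i : partial i (testv eta) x ^+ 2 <= dcut m eta i (x 0 i) ^+ 2.
  rewrite partial_testv exprMn ler_piMr ?sqr_ge0//.
  by have /andP[p0 p1] := P01 i; rewrite exprn_ile1.
rewrite big_ord_recl mulrDl; apply: lerD.
  by apply: le_trans (le_d _) _; exact: dcut0_bound.
have -> : 64 * n%:R * (eta ^+ 2 / x 0 ord0 ^+ 4 + 1) =
  \sum_(i < n) 64 * (eta ^+ 2 / x 0 ord0 ^+ 4 + 1).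
  by rewrite sumr_const card_ord -[RHS]mulr_natl; ring.
apply: ler_sum => i _; apply: le_trans (le_d _) _.
apply: (@le_trans _ _ (8 ^+ 2)); last by lra.
rewrite -(real_normK (num_real (dcut _ _ _ _))).
by apply: lerXn2r; rewrite ?nnegrE//; exact: dcut_bound.
Qed.

(** Since [grad phi = - F phi] where [eta <= x_0], differentiating [phi v] leaves only
    [phi grad v]. *)
Lemma drift_grad_testu eta x : 0 < eta ->
  drift_grad S eta (testu eta) x =
  if test_dom eta x then expR (lphi eta x) ^+ 2 * \sum_i partial i (testv eta) x ^+ 2 else 0.
Proof.
move=> eta0.
have main : eta <= x 0 ord0 -> drift_grad S eta (testu eta) x =
    expR (lphi eta x) ^+ 2 * \sum_i partial i (testv eta) x ^+ 2.
  move=> ex; rewrite /drift_grad big_distrr; apply: eq_bigr => i _ /=.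
  rewrite -exprMn; congr (_ ^+ 2).
  have dl : partial i (lphi eta) x = - drift S eta i x.
    rewrite /lphi partial_sum; last first.
      move=> k; apply: ckZ; apply: ck_ln; last exact: ck_reg_radius2.
      by move=> y; exact: reg_radius2_gt0.
    rewrite /drift [X in - X]big_mkcond -sumrN; apply: eq_bigr => k _.
    rewrite partialZ; last first.
      by apply: ck_ln; [move=> y; exact: reg_radius2_gt0|exact: ck_reg_radius2].
    rewrite (partial_comp (h := @ln R) (h' := GRing.inv) i (@ck_reg_radius2 R n 1 eta k)
      (is_derive1_ln (reg_radius2_gt0 k x eta0))).
    rewrite partial_reg_radius2//; case: (i <= k)%N; rewrite ?[true%:R]mulr1n ?[false%:R]mulr0n.
      by field; rewrite gt_eqF ?reg_radius2_gt0.
    by rewrite !mulr0 oppr0.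
  rewrite /testu partialM; [|exact/ck_expR/ck_lphi|exact: ck_testv].
  rewrite (partial_comp (h := expR) (h' := expR) i (ck_lphi 1 eta0) (is_derive_expR _)) dl.
  by ring.
case: ifPn => [/test_dom0/andP[ex _]|nd]; first exact: main.
have [xe|ex] := ltP (x 0 ord0) eta.
  rewrite /drift_grad big1// => i _.
  by rewrite (admissible_partial0 i (testu_admissible eta0) xe) testu_eq0// mulr0 addr0 expr0n.
(* Some coordinate [j] is outside its range: if [j = i] the differentiated factor is 0, otherwise a
   factor of the remaining product is. *)
rewrite main// big1 ?mulr0// => i _.
rewrite partial_testv; have /forallPn[j nj] := nd.
have [ji|ji] := eqVneq j i; first by rewrite -ji (cut_out eta0 nj).2 mul0r expr0n.
by rewrite (bigD1 j)//= (cut_out eta0 nj).1 mul0r mulr0 expr0n.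
Qed.

End TestFamily.

(** * Bound of the error terms, uniform in [eta] *)

Section UpperEstimate.
Variables (R : realType) (n m : nat) (alpha : nat -> R) (sg : R).
Hypotheses (mn : (m <= n)%N) (sg01 : 0 < sg <= 2^-1).
Hypothesis alpha_le : forall k, (k < m)%N -> alpha k <= - (m%:R * sg).
Implicit Types (x : 'rV[R]_n.+1) (k : nat) (eta xi t : R).

Let S := S_cut alpha m.

(** Index [i] is coordinate [i + 1] of the full space. For [i >= m] the cut-off gives
    [1 + t ^ 2 <= 17], and since [2^-1 + sg <= 1] the second branch is an integrable majorant of 1
    there. *)
Definition slice_kernel xi (i : 'I_n) t : R :=
  if (i < m)%N then kernel_pow xi sg t else 17 * kernel_pow 1 sg t.

(** The kernel bound has constant [2 / sg]; [34 = 2 * 17] serves both branches. *)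
Definition slice_bound xi (i : 'I_n) : R :=
  34 / sg * (if (i < m)%N then expR (- sg * ln (xi ^+ 2)) else 1).

Lemma slice_kernel_ge0 xi i t : 0 <= slice_kernel xi i t.
Proof. by rewrite /slice_kernel; case: ifP => _; rewrite ?mulr_ge0 ?expR_ge0. Qed.

Lemma upper1_slice_kernel xi i : 0 < xi -> upper1 (slice_kernel xi i) (slice_bound xi i).
Proof.
have sg0 : 0 < sg by case/andP: sg01.
move=> xi0 M g cg; rewrite /slice_kernel /slice_bound; case: ifP => _ gk.
  apply: le_trans (upper1_kernel_pow xi0 sg01 cg gk) _.
  set E := expR _; rewrite -subr_ge0 (_ : _ - _ = 32 * (E / sg)); last first.
    by field; rewrite gt_eqF.
  by rewrite mulr_ge0// divr_ge0 ?expR_ge0 ?ltW.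
have h := upper1_scale (ler0n R 17) (upper1_kernel_pow ltr01 sg01) cg gk.
apply: le_trans h _; rewrite expr1n ln1 mulr0 expR0 mulr1 le_eqVlt.
by apply/orP; left; apply/eqP; field; rewrite gt_eqF.
Qed.

Lemma prod_slice_bound xi : \prod_i slice_bound xi i =
  (34 / sg) ^+ n * expR (- (m%:R * sg) * ln (xi ^+ 2)).
Proof.
rewrite big_split /= prodr_const card_ord; congr (_ * _).
rewrite -big_mkcond /= -(big_ord_widen n (fun=> expR (- sg * ln (xi ^+ 2))) mn).
by rewrite prodr_const card_ord -expRM_natl; congr expR; ring.
Qed.

Lemma lphi_sqr eta x : 0 < eta -> eta <= x 0 ord0 ->
  expR (lphi S eta x) ^+ 2 = expR (- \sum_(k < n.+1) gam S k * ln (radius2 k x)).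
Proof.
move=> eta0 ex; rewrite expr2 -expRD; congr expR.
rewrite /lphi -sumrN -big_split /=; apply: eq_bigr => k _.
by rewrite reg_radius2E//; field.
Qed.

Lemma lphi_upper eta x : 0 < eta -> test_dom m eta x ->
  expR (lphi S eta x) ^+ 2 <=
  expR ((2^-1 + m%:R * sg) * ln (x 0 ord0 ^+ 2)) *
  \prod_(i < n) slice_kernel (x 0 ord0) i (x 0 (lift ord0 i)).
Proof.
move=> eta0 xd; have /andP[ex x1] := test_dom0 xd.
have x0 := lt_le_trans eta0 ex; have /andP[sg0 sg1] := sg01.
rewrite lphi_sqr//.
pose L k := ln (radius2 k x).
have LE : \sum_(k < n.+1) gam S k * ln (radius2 k x) = \sum_(k < m.+1) gam S k * L k.
  have mn1 : (m.+1 <= n.+1)%N by [].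
  rewrite (big_ord_widen n.+1 (fun k => gam S k * L k) mn1) [RHS]big_mkcond.
  apply: eq_bigr => k _; rewrite ltnS; case: leqP => // mk.
  by rewrite /S gam_cut0// mul0r.
have Lmono k l : (k <= l)%N -> L k <= L l.
  by move=> kl; rewrite ler_ln ?posrE ?radius2_gt0// radius2_le.
rewrite LE; apply: (@le_trans _ _ (expR ((2^-1 + m%:R * sg) * L 0 -
    (2^-1 + sg) * \sum_(k < m) L k.+1))).
  by rewrite ler_expR; exact: sum_gam_cut_upper (ltW sg0) alpha_le Lmono.
have -> : L 0 = ln (x 0 ord0 ^+ 2).
  rewrite /L /radius2 (bigD1 ord0)//= big1 ?addr0// => j /andP[].
  by rewrite leqn0 -val_eqE => ->.
rewrite expRD ler_wpM2l ?expR_ge0//.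
rewrite (big_ord_widen n (fun k => L k.+1) mn) -mulNr big_mkcond big_distrr /= expR_sum.
apply: ler_prod => i _; rewrite expR_ge0 /= /slice_kernel.
case: ifP => im.
  rewrite /kernel_pow ler_expR !mulNr lerN2 ler_wpM2l//; first by lra.
  rewrite ler_ln ?posrE ?radius2_gt0//; last by rewrite ltr_pwDl ?exprn_gt0 ?sqr_ge0.
  rewrite /radius2 (bigD1 ord0)//= lerD2l (bigD1 (lift ord0 i)) ?lift0 ?leqnn//=.
  by rewrite lerDl sumr_ge0// => j _; exact: sqr_ge0.
rewrite mulr0 expR0 /kernel_pow expr1n.
set t := x 0 _; have t0 : 0 < 1 + t ^+ 2 by rewrite ltr_pwDl ?sqr_ge0.
have tt : 1 + t ^+ 2 <= 17.
  have := forallP xd (lift ord0 i); rewrite /cut_dom /center lift0 im -/t /=.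
  by rewrite ler_norml => /andP[t1 t2]; nra.
rewrite mulNr expRN ler_pdivlMr ?expR_gt0// mul1r; apply: le_trans tt.
rewrite -[leRHS]lnK ?posrE// ler_expR ler_piMl//; last by lra.
by rewrite ln_ge0// lerDl sqr_ge0.
Qed.

Lemma integral_test_upper M (F : 'rV[R]_n.+1 -> R) eta (D : R) : 0 < eta < 1 -> 0 <= D ->
  cc M F -> (forall x, ~~ test_dom m eta x -> F x = 0) ->
  (forall x, test_dom m eta x ->
    F x <= D * (eta ^+ 2 / x 0 ord0 ^+ 4 + 1) * expR (lphi S eta x) ^+ 2) ->
  integral_Rn F <= D * (34 / sg) ^+ n.
Proof.
move=> /andP[eta0 eta1] D0 cF F0 FD; have /andP[sg0 sg1] := sg01.
pose E := D * (34 / sg) ^+ n.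
have E0 : 0 <= E by rewrite mulr_ge0// exprn_ge0// divr_ge0// ltW.
(* An antiderivative of [E (eta ^ 2 / t ^ 4 + 1) t]. Its increment over [[eta, 1]] is
   [E (1 - eta ^ 2)], bounded independently of [eta]. *)
pose G t := E * (t ^+ 2 / 2 - eta ^+ 2 / 2 * (t^-1 * t^-1)).
pose dG t := E * (t + eta ^+ 2 * (t^-1 * t^-1 * t^-1)).
have dGP t : eta <= t <= 1 -> is_derive t 1 G (dG t).
  move=> /andP[et _]; have t0 := lt_le_trans eta0 et.
  have dV := is_deriveV1 (lt0r_neq0 t0).
  have d := is_deriveZ E (is_deriveB (is_deriveM (is_derive_sqr t)
    (is_derive_cst (2^-1 : R) t 1))
    (is_deriveZ (eta ^+ 2 / 2) (is_deriveM dV dV))).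
  apply: (is_derive_eq d); rewrite /dG /= /GRing.scale /=.
  by field; rewrite gt_eqF.
have cdG t : eta <= t <= 1 -> {for t, continuous dG}.
  move=> /andP[et _]; have t0 := lt0r_neq0 (lt_le_trans eta0 et).
  have cV := inv_continuous t0.
  apply: (cvgM (cvg_cst _)); apply: cvgD; first exact: cvg_id.
  exact: (cvgM (cvg_cst _) (cvgM (cvgM cV cV) cV)).
have GG : G 1 - G eta <= E.
  rewrite (_ : G 1 - G eta = E * (1 - eta ^+ 2)); last first.
    by rewrite /G; field; rewrite gt_eqF.
  by rewrite ler_piMr// gerBl sqr_ge0.
apply: le_trans GG; apply: (cc1_le_antiderivative eta1 (cc_integral cF) _ cdG dGP) => [t nt|t te].
  rewrite (_ : (fun y => _) = fun=> 0) ?integral_Rn0//; apply/funext => y; apply: F0.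
  by apply: contra nt => /test_dom0; rewrite vcons0.
have t0 : 0 < t by case/andP: te => et _; exact: lt_le_trans et.
pose A := D * (eta ^+ 2 / t ^+ 4 + 1) * expR ((2^-1 + m%:R * sg) * ln (t ^+ 2)).
have r0 : 0 <= eta ^+ 2 / t ^+ 4 + 1 by rewrite addr_ge0// divr_ge0 ?exprn_ge0 ?ltW.
have A0 : 0 <= A by rewrite !mulr_ge0 ?expR_ge0.
apply: (@le_trans _ _ (A * \prod_i slice_bound t i)); last first.
  rewrite prod_slice_bound le_eqVlt; apply/orP; left; apply/eqP.
  have -> : dG t = E * (eta ^+ 2 / t ^+ 4 + 1) * t by rewrite /dG; field; rewrite gt_eqF.
  (* The gain [t ^ (2 m sg)] in [phi ^ 2] exactly offsets the [m] kernel integrals, each of order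
     [t ^ (- 2 sg)]. *)
  have Et : expR ((2^-1 + m%:R * sg) * ln (t ^+ 2)) * expR (- (m%:R * sg) * ln (t ^+ 2)) = t.
    rewrite -expRD -mulrDl addrK lnXn//.
    by rewrite (_ : 2^-1 * (ln t *+ 2) = ln t) ?lnK ?posrE//; field.
  by rewrite /A; set r := _ + 1; rewrite -[X in _ = _ * X]Et /E; ring.
apply: (integral_Rn_upper A0 (slice_kernel_ge0 t) _ _ (cc_slice t cF)) => [i|i|y].
- rewrite /slice_bound mulr_ge0 ?divr_ge0 ?(ltW sg0)//; case: ifP => // _; exact: expR_ge0.
- exact: upper1_slice_kernel.
have [yd|yd] := boolP (test_dom m eta (vcons t y)); last first.
  by rewrite F0// mulr_ge0// prodr_ge0// => i _; exact: slice_kernel_ge0.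
apply: le_trans (FD _ yd) _; rewrite vcons0 /A -[leRHS]mulrA ler_wpM2l ?mulr_ge0//.
apply: le_trans (lphi_upper eta0 yd) _; rewrite vcons0.
rewrite (eq_bigr (fun i => slice_kernel t i (y 0 i)))// => i _.
by rewrite vconsS.
Qed.

End UpperEstimate.

(** * Logarithmic growth of the critical term *)

Section LowerEstimate.
Variables (R : realType) (n m : nat) (alpha : nat -> R).
Hypothesis mn : (m <= n)%N.
Implicit Types (x : 'rV[R]_n.+1) (k : nat) (eta t : R).

Let S := S_cut alpha m.
Let w : R := flat 0 2^-1.

(** [w] bounds below each of the [n + 2] flat factors of [v], two of which belong to [x_0]; [n + 1]
    comes from [r_m ^ 2 <= (n + 1) t ^ 2], and the exponential from the spread [ln (n + 1)] of the
    logarithms of the radii. *)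
Definition lower_const : R :=
  (w ^+ n.+2) ^+ 2 / n.+1%:R * expR (- ((\sum_(k < n.+1) `|gam S k|) * ln n.+1%:R)).

Lemma lower_const_gt0 : 0 < lower_const.
Proof. by rewrite mulr_gt0 ?expR_gt0// divr_gt0// !exprn_gt0// flat_gt0. Qed.

(** On this box all radii up to [r_m] are comparable to [t], and every cut-off argument is at least
    1/2 when [2 eta <= t <= 1/2]. *)
Definition in_box t x := forall j : 'I_n.+1,
  if j == ord0 then x 0 j = t
  else if (j <= m)%N then 0 <= x 0 j <= t else 5 / 2 <= x 0 j <= 7 / 2.

Lemma in_box0 t x : in_box t x -> x 0 ord0 = t.
Proof. by move=> xb; have := xb ord0. Qed.

Lemma testv_lower eta t x : 0 < eta -> 2 * eta <= t <= 2^-1 -> in_box t x ->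
  w ^+ n.+2 <= testv m eta x.
Proof.
move=> eta0 /andP[et t1] xb; have w0 : 0 < w by rewrite flat_gt0.
have w1 : w <= 1 by exact: flat0_le1.
rewrite /testv big_ord_recl !exprS mulrA; apply: ler_pM.
- by rewrite mulr_ge0 ?ltW.
- by rewrite exprn_ge0 ?ltW.
- rewrite (in_box0 xb) /cut /=.
  apply: ler_pM; rewrite ?(ltW w0)//; apply: flat0_le; last by lra.
  have : 2 <= eta^-1 * t by rewrite -ler_pdivrMl ?invr_gt0// invrK mulrC.
  by lra.
rewrite -[X in _ ^+ X]card_ord -prodr_const; apply: ler_prod => i _; rewrite (ltW w0) /=.
have := xb (lift ord0 i); rewrite /cut /center lift0 /=; set s := x 0 _.
case: ifP => _ /andP[s0 s1]; apply: flat0_le; nra.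
Qed.

Lemma radius2_box t x k : 0 < t -> in_box t x -> (k <= m)%N ->
  t ^+ 2 <= radius2 k x <= n.+1%:R * t ^+ 2.
Proof.
move=> t0 xb km; apply/andP; split.
  by rewrite -(in_box0 xb); exact: radius2_ge.
have -> : n.+1%:R * t ^+ 2 = \sum_(j < n.+1) t ^+ 2 by rewrite sumr_const card_ord mulr_natl.
rewrite /radius2 big_mkcond; apply: ler_sum => j _; case: ifP => [jk|_]; last exact: sqr_ge0.
have := xb j; case: eqP => [_ ->//|_]; rewrite (leq_trans jk km) => /andP[x0 xt].
by apply: lerXn2r; rewrite ?nnegrE// ltW.
Qed.

Lemma testu_lower eta t x : 0 < eta -> 2 * eta <= t <= 2^-1 -> in_box t x ->
  lower_const * expR (- ((m%:R - 1) / 2 * ln (t ^+ 2))) / t ^+ 2 <=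
  testu m S eta x ^+ 2 / radius2 m x.
Proof.
move=> eta0 te xb; have /andP[et t1] := te.
have t0 : 0 < t by lra.
have xt := in_box0 xb.
have x0 : 0 < x 0 ord0 by rewrite xt.
have q0 k : 0 < radius2 k x by exact: radius2_gt0.
rewrite exprMn lphi_sqr//; last by rewrite xt; lra.
set c := _ * ln (t ^+ 2).
have h1 : expR (- c) * expR (- ((\sum_(k < n.+1) `|gam S k|) * ln n.+1%:R)) <=
    expR (- \sum_(k < n.+1) gam S k * ln (radius2 k x)).
  rewrite -expRD ler_expR -opprD lerN2.
  apply: (@sum_gam_cut_lower _ _ _ (fun k => ln (radius2 k x)) (ln (t ^+ 2)) (ln n.+1%:R) n mn) => k km.
  have /andP[q1 q2] := radius2_box t0 xb km.
  rewrite ler_ln ?posrE ?exprn_gt0// q1 /= addrC -lnM ?posrE ?exprn_gt0//.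
  by rewrite ler_ln ?posrE ?mulr_gt0 ?exprn_gt0.
have h2 : (w ^+ n.+2) ^+ 2 <= testv m eta x ^+ 2.
  apply: lerXn2r; rewrite ?nnegrE ?testv_ge0 ?exprn_ge0 ?flat_ge0//.
  exact: testv_lower te xb.
have h3 : (n.+1%:R * t ^+ 2)^-1 <= (radius2 m x)^-1.
  have /andP[_ q2] := radius2_box t0 xb (leqnn m).
  by rewrite lef_pV2 ?posrE ?mulr_gt0 ?exprn_gt0.
have -> : lower_const * expR (- c) / t ^+ 2 =
  (expR (- c) * expR (- ((\sum_(k < n.+1) `|gam S k|) * ln n.+1%:R))) * (w ^+ n.+2) ^+ 2
    * (n.+1%:R * t ^+ 2)^-1.
  rewrite /lower_const; have : n.+1%:R != 0 :> R by [].
  by move: n.+1%:R => N N0; field; rewrite N0 gt_eqF.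
have n0 : 0 <= (n.+1%:R * t ^+ 2)^-1 by rewrite invr_ge0; apply: mulr_ge0; [exact: ler0n|exact: sqr_ge0].
apply: ler_pM => //; first by apply: mulr_ge0; [rewrite mulr_ge0 ?expR_ge0|exact: sqr_ge0].
by apply: ler_pM => //; first [exact: sqr_ge0|by rewrite mulr_ge0 ?expR_ge0].
Qed.

Lemma integral_test_lower M (F : 'rV[R]_n.+1 -> R) eta : 0 < eta < 8^-1 ->
  cc M F -> (forall x, 0 <= F x) ->
  (forall x, 0 < x 0 ord0 -> testu m S eta x ^+ 2 / radius2 m x <= F x) ->
  lower_const * (ln 2^-1 - ln (2 * eta)) <= integral_Rn F.
Proof.
move=> /andP[eta0 eta1] cF F0 FD; have c0 := lower_const_gt0.
pose G t : R := lower_const * ln t.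
pose dG t : R := lower_const * t^-1.
have ab : 2 * eta < 2^-1 by lra.
have tpos t : 2 * eta <= t <= 2^-1 -> 0 < t by move=> /andP[t1 _]; lra.
have dGP t : 2 * eta <= t <= 2^-1 -> is_derive t 1 G (dG t).
  by move=> /tpos t0; exact: (is_deriveZ lower_const (is_derive1_ln t0)).
have cdG t : 2 * eta <= t <= 2^-1 -> {for t, continuous dG}.
  by move=> /tpos t0; exact: (cvgM (cvg_cst _) (inv_continuous (lt0r_neq0 t0))).
rewrite mulrBr -/(G _) -/(G _).
apply: (cc1_ge_antiderivative ab (cc_integral cF) _ cdG dGP) => [t|t te].
  by apply: integral_Rn_ge0.
have t0 := tpos t te.
pose A := lower_const * expR (- ((m%:R - 1) / 2 * ln (t ^+ 2))) / t ^+ 2.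
have A0 : 0 <= A.
  by apply: divr_ge0; [apply: mulr_ge0; [exact: ltW|exact: expR_ge0]|exact: sqr_ge0].
pose a (i : 'I_n) : R := if (i < m)%N then 0 else 5 / 2.
pose b (i : 'I_n) : R := if (i < m)%N then t else 7 / 2.
(* Power count: [t ^ (1 - m)] from [phi ^ 2], [t ^ (-2)] from the weight and [t ^ m] from the volume
   of the box leave [1 / t]. *)
have -> : dG t = A * \prod_i (b i - a i).
  have -> : \prod_i (b i - a i) = t ^+ m.
    rewrite (eq_bigr (fun i : 'I_n => if (i < m)%N then t else 1)); last first.
      by move=> i _; rewrite /b /a; case: ifP => _; [rewrite subr0|field].
    rewrite -big_mkcond /= -(big_ord_widen n (fun=> t) mn).
    by rewrite prodr_const card_ord.
  have Et : expR (- ((m%:R - 1) / 2 * ln (t ^+ 2))) * t ^+ m = t.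
    rewrite -{2}(lnK (_ : t \is Num.pos)) ?posrE// -expRM_natl -expRD lnXn//.
    by rewrite (_ : _ + _ = ln t) ?lnK ?posrE//; field.
  rewrite /A /dG; set E := expR _ in Et *.
  have -> : lower_const * E / t ^+ 2 * t ^+ m = lower_const * (E * t ^+ m) / t ^+ 2.
    by field; rewrite gt_eqF.
  by rewrite Et; field; rewrite gt_eqF.
apply: (integral_Rn_lower (a := a) (b := b) A0 _ (cc_slice t cF)) => [i|y|y yab].
- by rewrite /a /b; case: ifP => _; lra.
- exact: F0.
apply: (@le_trans _ _ (testu m S eta (vcons t y) ^+ 2 / radius2 m (vcons t y))); last first.
  by apply: FD; rewrite vcons0.
apply: testu_lower => // j; case: (unliftP ord0 j) => [i|] ->; last by rewrite eqxx vcons0.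
by rewrite vconsS lift0; have := yab i; rewrite /a /b /=; case: ifP.
Qed.

End LowerEstimate.

(** * Part (ii): contradiction, perturbation and the recursive choice of [alpha] *)

Section Necessity.
Variables (R : realType) (n : nat).
Implicit Types (x : 'rV[R]_n.+1) (a alpha beta : nat -> R) (m k N : nat).

Lemma uniform_negative a N : (forall k, (k < N)%N -> a k < 0) ->
  exists2 c : R, 0 < c & forall k, (k < N)%N -> a k <= - c.
Proof.
elim: N => [|N IH] aN; first by exists 1.
have [k kN|c c0 cN] := IH; first by apply: aN; rewrite ltnW.
exists (Num.min c (- a N)) => [|k]; first by rewrite lt_min c0 oppr_gt0 aN.
rewrite ltnS leq_eqVlt => /predU1P[->|kN].
  by rewrite lerNr ge_min lexx orbT.
by apply: le_trans (cN k kN) _; rewrite lerN2 ge_min lexx.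
Qed.

Lemma test_error_upper alpha beta m (sg eta : R) : (m <= n)%N -> 0 < sg <= 2^-1 ->
  (forall k, (k < m)%N -> alpha k <= - (m%:R * sg)) -> 0 < eta < 1 ->
  integral_Rn (fun x => hardy_weight
      (fun k : 'I_n.+1 => if (m < k)%N then `|beta k| else 0) x *
      testu m (S_cut alpha m) eta x ^+ 2 +
    1 * drift_grad (S_cut alpha m) eta (testu m (S_cut alpha m) eta) x) <=
  (\sum_(k < n.+1) `|beta k| + (32 + 64 * n%:R)) * (34 / sg) ^+ n.
Proof.
move=> mn sg01 al eta01; set u := testu _ _ eta; have /andP[eta0 eta1] := eta01.
have adm := testu_admissible n m (S_cut alpha m) eta0.
pose b (k : 'I_n.+1) := if (m < k)%N then `|beta k| else 0.
rewrite -[X in hardy_weight X]/b.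
have cF := cc_lin 1 (cc_hardy_weight b adm) (cc_drift_grad (S_cut alpha m) adm).
have B0 : 0 <= \sum_(k < n.+1) `|beta k| by apply: sumr_ge0.
apply: (integral_test_upper mn sg01 al eta01 _ cF) => [|x xd|x xd].
- by rewrite addr_ge0// addr_ge0// mulr_ge0.
- by rewrite drift_grad_testu// (negbTE xd) mulr0 addr0 /u /testu testv_out// mulr0 expr0n mulr0.
rewrite drift_grad_testu// xd mul1r; set E := expR _ ^+ 2.
have /andP[ex x1] := test_dom0 xd; have x0 := lt_le_trans eta0 ex.
have E0 : 0 <= E by exact: sqr_ge0.
have r0 : 0 <= eta ^+ 2 / x 0 ord0 ^+ 4 by rewrite divr_ge0 ?exprn_ge0 ?(ltW x0)// ltW.
rewrite mulrDl mulrDl; apply: lerD; last first.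
  by rewrite mulrC ler_wpM2r//; exact: sum_partial_testv.
have uE : u x ^+ 2 <= E.
  rewrite exprMn ler_piMr// exprn_ile1 ?testv_ge0//; exact: testv_le1.
(* For [k > m] the cut-off forces [x_k >= 2], so [r_k ^ 2 >= 1]. *)
have hb : hardy_weight b x <= \sum_(k < n.+1) `|beta k|.
  apply: ler_sum => k _; rewrite -/(radius2 k x) /b; case: ifP => [mk|]; last by rewrite mul0r.
  rewrite ler_pdivrMr ?radius2_gt0// ler_peMr//.
  apply: le_trans (radius2_ge x (leqnn k)).
  have := forallP xd k; rewrite /cut_dom /center leqNgt mk /= gtn_eqF ?(leq_ltn_trans _ mk)//.
  by rewrite ler_norml => /andP[h1 h2]; nra.
have hb0 : 0 <= hardy_weight b x.
  apply: sumr_ge0 => k _; rewrite -/(radius2 k x) divr_ge0 ?radius2_ge0// /b.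
  by case: ifP.
apply: (@le_trans _ _ ((\sum_(k < n.+1) `|beta k|) * E)).
  by apply: ler_pM => //; exact: sqr_ge0.
by rewrite ler_wpM2r// ler_peMr//; lra.
Qed.

(** The lower coefficients are only compared with [beta] by an inequality, so that the statement
    applies to perturbed exponents. *)
Lemma hardy_step alpha beta m : (m <= n)%N ->
  hardy_ineq (fun k : 'I_n.+1 => beta k) ->
  (forall k, (k < m)%N -> alpha k < 0) ->
  (forall k, (k < m)%N -> - alpha k ^+ 2 + prev_sq alpha k <= beta k) ->
  beta m <= prev_sq alpha m.
Proof.
move=> mn hb aneg ab; rewrite leNgt; apply/negP => bm.
pose d := beta m - prev_sq alpha m; have d0 : 0 < d by rewrite subr_gt0.
have [c c0 ac] := uniform_negative aneg.
(* Ensures [m sg <= c]; dividing by [m + 1] also covers [m = 0]. *)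
pose sg : R := Num.min 2^-1 (c / m.+1%:R).
have sg0 : 0 < sg by rewrite lt_min invr_gt0 ltr0n divr_gt0.
have sg01 : 0 < sg <= 2^-1 by rewrite sg0 ge_min lexx.
have asg k : (k < m)%N -> alpha k <= - (m%:R * sg).
  move=> /ac h; apply: le_trans h _; rewrite lerN2.
  apply: (@le_trans _ _ (m.+1%:R * sg)); first by rewrite ler_wpM2r ?ler_nat ?(ltW sg0).
  by rewrite mulrC -ler_pdivlMr// ge_min lexx orbT.
set S := S_cut alpha m.
have c1 := lower_const_gt0 n m alpha; set c2 := lower_const n m alpha in c1.
set C := (\sum_(k < n.+1) `|beta k| + (32 + 64 * n%:R)) * (34 / sg) ^+ n.
have C0 : 0 <= C.
  apply: mulr_ge0; last by rewrite exprn_ge0 ?divr_ge0 ?(ltW sg0).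
  by rewrite addr_ge0 ?sumr_ge0// addr_ge0// mulr_ge0.
(* [T] will be the length of the logarithmic interval, and [d c2 T = C + 2 d c2] exceeds the error
   bound [C]. The summand 2 also secures [exp (- T) < 1/2], that is [eta < 1/8]. *)
pose T := C / (d * c2) + 2.
have T2 : 2 <= T by rewrite lerDr divr_ge0// mulr_ge0 ?(ltW d0) ?(ltW c1).
pose eta := expR (- T) / 4.
have eta0 : 0 < eta by rewrite divr_gt0// expR_gt0.
have eta8 : eta < 8^-1.
  rewrite /eta expRN ltr_pdivrMr//.
  have -> : 8^-1 * 4 = 2^-1 :> R by field.
  rewrite ltf_pV2 ?posrE ?expR_gt0//.
  by apply: lt_le_trans (expR_ge1Dx _); lra.
have eta1 : 0 < eta < 1 by rewrite eta0 /=; lra.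
pose u := testu m S eta (n := n).
have adm : admissible eta 5 u by exact: testu_admissible.
have [_ _ cu u0] := adm.
pose b0 (k : 'I_n.+1) : R := (k == m :> nat)%:R.
pose b2 (k : 'I_n.+1) : R := if (m < k)%N then `|beta k| else 0.
pose bw (k : 'I_n.+1) := radial_weight S k.
have cw := cc_hardy_weight bw adm.
have c0' := cc_hardy_weight b0 adm.
have cb2 := cc_hardy_weight b2 adm.
have cb := cc_hardy_weight (fun k : 'I_n.+1 => beta k) adm.
have cg := cc_drift_grad S adm.
have lowF : c2 * T <= integral_Rn (fun x => hardy_weight b0 x * u x ^+ 2).
  have -> : T = ln 2^-1 - ln (2 * eta).
    rewrite /eta (_ : 2 * (expR (- T) / 4) = expR (- T) * 2^-1); last by field.
    by rewrite lnM ?posrE ?expR_gt0// expRK; ring.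
  apply: (integral_test_lower mn _ c0') => [|x|x x0].
  - by rewrite eta0.
  - rewrite mulr_ge0 ?sqr_ge0//; apply: sumr_ge0 => k _.
    by rewrite -/(radius2 k x) divr_ge0 ?radius2_ge0.
  rewrite mulrC -/u ler_wpM2r ?sqr_ge0//.
  have mn1 : (m < n.+1)%N by [].
  rewrite /hardy_weight (bigD1 (Ordinal mn1))//= -/(radius2 m x) /b0 /= eqxx mul1r lerDl.
  by apply: sumr_ge0 => k _; rewrite -/(radius2 k x) divr_ge0 ?radius2_ge0.
have upF : integral_Rn (fun x => hardy_weight b2 x * u x ^+ 2 + 1 * drift_grad S eta u x) <= C.
  exact: (test_error_upper beta mn sg01 asg eta1).
rewrite (integral_Rn_lin _ cb2 cg) mul1r in upF.
have hu := hb u (testu_C0inf n m S eta0).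
rewrite (integral_grad_sq S adm) in hu.
have cL := cc_lin (-1) (cc_lin d cw c0') cb2.
(* Termwise: the hypothesis on [beta] for [k < m], equality at [m] by the choice of [d], and
   [- |beta k| <= beta k] for [k > m]. *)
have ptw x : (hardy_weight bw x * u x ^+ 2 + d * (hardy_weight b0 x * u x ^+ 2)) +
    -1 * (hardy_weight b2 x * u x ^+ 2) <=
    hardy_weight (fun k : 'I_n.+1 => beta k) x * u x ^+ 2.
  move: (u x) => s; rewrite [leLHS](_ : _ =
    (hardy_weight bw x + d * hardy_weight b0 x + -1 * hardy_weight b2 x) * s ^+ 2); last by ring.
  rewrite ler_wpM2r ?sqr_ge0// /hardy_weight !big_distrr -!big_split /=.
  apply: ler_sum => k _; rewrite -/(radius2 k x) !mulrA -!mulrDl.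
  rewrite ler_wpM2r ?invr_ge0 ?radius2_ge0//.
  rewrite /bw /b0 /b2 /S radial_weight_cut; case: (ltngtP k m) => [km|mk|->].
  - by rewrite mulr0 addr0 mulr0 addr0 ab.
  - by rewrite mulr0 !add0r mulN1r lerNl ler_normr lexx orbT.
  - by rewrite mulr1 mulr0 addr0 /d addrC subrK.
have := integral_Rn_le cL cb ptw.
rewrite (integral_Rn_lin _ (cc_lin d cw c0') cb2) (integral_Rn_lin _ cw c0').
move=> hI; have hT : d * (c2 * T) <= C.
  apply: le_trans (ler_wpM2l (ltW d0) lowF) _; apply: le_trans upF.
  by move: hu hI; rewrite -/bw; lra.
move: hT; rewrite mulrA /T mulrDr mulrCA divff ?mulr1; last by rewrite mulf_neq0// gt_eqF.
by apply/negP; rewrite -ltNge ltrDl; have := mulr_gt0 d0 c1; lra.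
Qed.

(* Lowering a nonpositive [alpha_N] by [eps] lowers the N-th coefficient by at
   least [eps ^ 2], which pays for a smaller perturbation of [alpha_(N-1)]. *)
Lemma perturb_nonpos alpha N (eps : R) : (forall k, alpha k <= 0) -> 0 < eps ->
  exists a, [/\ forall k, (k <= N)%N -> a k < 0,
    forall k, (k <= N)%N ->
      - a k ^+ 2 + prev_sq a k <= - alpha k ^+ 2 + prev_sq alpha k
    & a N = alpha N - eps].
Proof.
move=> al; elim: N eps => [|N IH] eps eps0.
  exists (fun=> alpha 0%N - eps); split=> // k.
    by move=> _; have := al 0%N; lra.
  rewrite leqn0 => /eqP -> /=; rewrite lerD2r lerN2; have := al 0%N; nra.
(* Lowering [alpha N] by [e' <= 1] raises [(alpha N - 1/2) ^ 2] by [e' (e' + 1 - 2 alpha N)], at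
   most [e' (2 - 2 alpha N) <= eps ^ 2]. *)
pose e' : R := Num.min 1 (eps ^+ 2 / (2 - 2 * alpha N)).
have D0 : 0 < 2 - 2 * alpha N by have := al N; lra.
have e'0 : 0 < e' by rewrite lt_min ltr01 divr_gt0 ?exprn_gt0.
have e'1 : e' <= 1 by rewrite ge_min lexx.
have e'2 : e' * (2 - 2 * alpha N) <= eps ^+ 2.
  by rewrite -ler_pdivlMr// ge_min lexx orbT.
have [a' [neg' le' aN]] := IH e' e'0.
exists (fun k => if (k <= N)%N then a' k else alpha N.+1 - eps); split.
- move=> k _; case: ifP => [|_]; first exact: neg'.
  by have := al N.+1; lra.
- move=> k; rewrite leq_eqVlt => /predU1P[->|]; last first.
    rewrite ltnS => kN; rewrite kN; have := le' k kN.
    by case: k kN => [|k] kN //=; rewrite (ltnW kN).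
  rewrite ltnn /= leqnn aN; have := al N; have := al N.+1.
  move: (alpha N.+1) (alpha N) D0 e'2 => p q D0 e'2 p0 q0.
  have : e' * (e' + 1 - 2 * q) <= e' * (2 - 2 * q) by rewrite ler_wpM2l ?(ltW e'0)//; lra.
  have : 0 <= - p * eps by rewrite mulr_ge0 ?(ltW eps0)// oppr_ge0.
  lra.
- by rewrite ltnn.
Qed.

Lemma hardy_step_nonpos alpha beta m : (m <= n)%N ->
  hardy_ineq (fun k : 'I_n.+1 => beta k) ->
  (forall k, alpha k <= 0) ->
  (forall k, (k < m)%N -> - alpha k ^+ 2 + prev_sq alpha k = beta k) ->
  beta m <= prev_sq alpha m.
Proof.
move=> mn hb al ab; case: m mn ab => [|m] mn ab; first exact: (hardy_step (alpha := alpha)) hb _ _.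
rewrite leNgt; apply/negP => bm.
pose d := beta m.+1 - prev_sq alpha m.+1; have d0 : 0 < d by rewrite subr_gt0.
have D0 : 0 < 4 - 4 * alpha m by have := al m; lra.
(* The perturbation raises [prev_sq] at [m.+1] by at most [eps (2 - 2 alpha m) <= d / 2], too little
   to reach [beta m.+1]. *)
pose eps : R := Num.min 1 (d / (4 - 4 * alpha m)).
have eps0 : 0 < eps by rewrite lt_min ltr01 divr_gt0.
have eps1 : eps <= 1 by rewrite ge_min lexx.
have eps2 : eps * (4 - 4 * alpha m) <= d by rewrite -ler_pdivlMr// ge_min lexx orbT.
have [a [neg le_a am]] := perturb_nonpos m al eps0.
have : beta m.+1 <= prev_sq a m.+1.
  apply: hardy_step mn hb _ _ => k; rewrite ltnS => km; first exact: neg.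
  by rewrite -ab//; exact: le_a.
rewrite /= am; move: eps2; rewrite /d /=; move: bm; rewrite /=.
have := al m; move: (alpha m) => q q0; nra.
Qed.

(** The nonpositive root is taken at each index. [Num.sqrt] is 0 on negative arguments, so the
    recursion is total; [alpha_recP] shows that the Hardy inequality keeps the arguments up to [n]
    nonnegative. *)
Fixpoint alpha_rec beta k : R :=
  if k is k'.+1 then - Num.sqrt ((alpha_rec beta k' - 1 / 2) ^+ 2 - beta k)
  else - Num.sqrt (1 / 4 - beta 0%N).

Lemma alpha_recE beta k : alpha_rec beta k = - Num.sqrt (prev_sq (alpha_rec beta) k - beta k).
Proof. by case: k. Qed.

Lemma alpha_rec_le0 beta k : alpha_rec beta k <= 0.
Proof. by rewrite alpha_recE oppr_le0 sqrtr_ge0. Qed.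

Lemma alpha_recP beta : hardy_ineq (fun k : 'I_n.+1 => beta k) ->
  forall m, (m <= n)%N -> - alpha_rec beta m ^+ 2 + prev_sq (alpha_rec beta) m = beta m.
Proof.
move=> hb; elim/ltn_ind => m IH mn.
have h : beta m <= prev_sq (alpha_rec beta) m.
  apply: hardy_step_nonpos => // [k|k km]; first exact: alpha_rec_le0.
  by apply: IH => //; exact: leq_trans (ltnW km) mn.
by rewrite alpha_recE sqrrN sqr_sqrtr ?subr_ge0// opprB subrK.
Qed.

Lemma beta_of_hardy (beta : 'I_n.+1 -> R) : hardy_ineq beta ->
  exists alpha : 'I_n.+1 -> R, (forall i, alpha i <= 0) /\ beta_of alpha beta.
Proof.
move=> hb; pose bn k := beta (inord k).
have bE : beta = fun k : 'I_n.+1 => bn k by apply/funext => k; rewrite /bn inord_val.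
exists (fun k => alpha_rec bn k); split=> [k|]; first exact: alpha_rec_le0.
apply/beta_ofP => k; rewrite bE in hb; rewrite (alpha_recP hb) ?bE//.
by rewrite -ltnS.
Qed.

End Necessity.

(* Dimension is n.+1 (i.e. n >= 1 in the paper's notation, paper's n = n.+1);
   indices 1..n of the paper are 'I_n.+1 = {0,...,n}. *)
Theorem theoremA (R : realType) (n : nat) :
  (forall alpha beta : 'I_n.+1 -> R, beta_of alpha beta -> hardy_ineq beta) /\
  (forall beta : 'I_n.+1 -> R, hardy_ineq beta ->
     exists alpha : 'I_n.+1 -> R, (forall m, alpha m <= 0) /\ beta_of alpha beta).
Proof. by split; [exact: hardy_of_beta|exact: beta_of_hardy]. Qed.
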